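(* Let $n\ge 3$ be an integer and let $N\in\mathbb{R}$ with $N_{\min}(n)<N<+\infty$. Consider, for real $u$, the transcendental equation in the unknown $v$ $$\sinh^2(nv)-N^2\sinh^2 v=N^2\sin^2 u-\sin^2(nu).\qquad( * )$$ **Case 1.** If $N>n$, then for every $u\in R(n,N)=[-\pi,\pi]$ the equation $( * )$ has a unique positive root $v=v(n,N,u)\in(0,+\infty)$. Furthermore $v(n,N,u)\ge v_0(n,N)$ for all $u\in[-\pi,\pi]$, with equality if and only if $u=0$ or $|u|=\pi$. **Case 2.** If $N_{\min}(n)<N\le n$, then for every $u\in R(n,N)=\{u\in\mathbb{R}: u_0(n,N)\le |u|\le \pi-u_0(n,N)\}$ the equation $( * )$ has a unique nonnegative root $v=v(n,N,u)\in[0,+\infty)$. In both cases, for $u\in R(n,N)$ set $\mu(n,N,u)=u+i\,v(n,N,u)$ and $$f_{n,N}^{(1)}(u)=\frac{\sin\frac{(n+1)\mu(n,N,u)}{2}}{\sin\frac{(n-1)\mu(n,N,u)}{2}},\qquad b_{n,N}^{(1)}(u)=-\frac{\sin[n\mu(n,N,u)]}{\sin\mu(n,N,u)},$$ $$f_{n,N}^{(2)}(u)=\frac{\cos\frac{(n+1)\mu(n,N,u)}{2}}{\cos\frac{(n-1)\mu(n,N,u)}{2}},\qquad b_{n,N}^{(2)}(u)=\frac{\sin[n\mu(n,N,u)]}{\sin\mu(n,N,u)}.$$ Then for each $k\in\{1,2\}$, each $\rho\in\mathbb{C}$ and each $\lambda\in\mathbb{C}$: $\lambda$ is a type-$k$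 eigenvalue of $K_n(\rho)$ with $|\lambda|=N$ if and only if there exists $u\in R(n,N)$ such that $\rho=f_{n,N}^{(k)}(u)$ and $\lambda=b_{n,N}^{(k)}(u)$.
   Context: For an integer $n\ge3$ and $\rho\in\mathbb{C}$, $K_n(\rho)=[\rho^{|j-k|}]_{j,k=1}^n$ is the $n\times n$ Kac--Murdock--Szegő matrix (diagonal entries equal to $1$). An eigenvalue of $K_n(\rho)$ is of type-1 if it is associated with a (nonzero) skew-symmetric eigenvector $x$ ($x_{n+1-j}=-x_j$ for all $j$), and of type-2 if it is associated with a (nonzero) symmetric eigenvector $x$ ($x_{n+1-j}=x_j$ for all $j$). $U_{k}$ is the Chebyshev polynomial of the second kind of degree $k$, $U_k(\cos u)=\sin[(k+1)u]/\sin u$. $N_{\min}(n)=|U_{n-1}(x_0'(n))|$, where $x_0'(n)$ is the unique solution of $U_{n-1}'(x)=0$ with $\cos\frac{2\pi}{n}<x<\cos\frac{\pi}{n}$; it satisfies $1\le N_{\min}(n)<n$. For $N>n$, $v_0(n,N)$ is the unique (positive) solution $v$ of $\sinh(nv)/\sinh v=N$, $v\ge0$ (the left side is understood as $n$ at $v=0$). For $N_{\min}(n)<N<n$, $u_0(n,N)=\arccos[x_0(n,N)]$, where $x_0(n,N)$ is the unique positive solution of $|U_{n-1}(x)|=N$ in $-1<x<1$; it satisfies $0<u_0(n,N)<\pi/n$. For $N=n$ one uses the limiting value $u_0(n,n)=0$. Quotients of trigonometric functions of $\mu$ that take the form $0/0$ (this happens only when $N=n$ and $\mu\in\{0,\pm\pi\}$)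 are understood as the limits in $\mu$, i.e. with removable singularities removed. *)

(* Defs.v *)
From HB Require Import structures.
From mathcomp Require Import all_boot all_order all_algebra.
From mathcomp Require Import complex ring.
From mathcomp Require Import all_classical all_reals all_analysis.

Set Implicit Arguments.
Unset Strict Implicit.
Unset Printing Implicit Defensive.

Import Order.TTheory GRing.Theory Num.Theory.
Import numFieldNormedType.Exports.

Local Open Scope classical_set_scope.
Local Open Scope ring_scope.
Local Open Scope complex_scope.

Section KMSMatrix.
Variable R : realType.

Definition KMS (n : nat) (rho : R[i]) : 'M[R[i]]_n :=
  \matrix_(j < n, k < n) rho ^+ `|j%:Z - k%:Z|%N.

(* [rev_ord j] is the 0-based counterpart of the index n + 1 - j. *)
Definition skew_symmetric_vec (n : nat) (x : 'cV[R[i]]_n) : Prop :=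
  forall j, x (rev_ord j) 0 = - x j 0.

Definition symmetric_vec (n : nat) (x : 'cV[R[i]]_n) : Prop :=
  forall j, x (rev_ord j) 0 = x j 0.

Definition type1_eigenvalue (n : nat) (A : 'M[R[i]]_n) (lambda : R[i]) : Prop :=
  exists x : 'cV[R[i]]_n,
    [/\ x != 0, skew_symmetric_vec x & A *m x = lambda *: x].

Definition type2_eigenvalue (n : nat) (A : 'M[R[i]]_n) (lambda : R[i]) : Prop :=
  exists x : 'cV[R[i]]_n,
    [/\ x != 0, symmetric_vec x & A *m x = lambda *: x].

End KMSMatrix.

Section RealAuxiliaries.
Variable R : realType.
Implicit Types (n k : nat) (N u v x : R).

Definition sinh (x : R) : R := (expR x - expR (- x)) / 2.

Fixpoint chebU (k : nat) : {poly R} :=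
  if k is k1.+1 then
    if k1 is k2.+1 then (2%:P * 'X) * chebU k1 - chebU k2 else 2%:P * 'X
  else 1.

Lemma chebU_cos k u : (chebU k).[cos u] * sin u = sin (k.+1%:R * u).
Proof.
suff [] : (chebU k).[cos u] * sin u = sin (k.+1%:R * u) /\
          (chebU k.+1).[cos u] * sin u = sin (k.+2%:R * u) by [].
elim: k => [|k [IH1 IH2]]; split => //.
- by rewrite /= hornerE !mul1r.
- have -> : 2%:R * u = u + u by ring.
  by rewrite /= !hornerE sinD; ring.
have -> : (chebU k.+2).[cos u] =
          2 * cos u * (chebU k.+1).[cos u] - (chebU k).[cos u].
  by rewrite [chebU k.+2]/= hornerD hornerN !hornerM hornerX hornerC.
rewrite mulrBl IH1 -(mulrA (2 * cos u)) IH2.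
have -> : k.+3%:R * u = k.+2%:R * u + u by rewrite -[in LHS]natr1 mulrDl mul1r.
have -> : k.+1%:R * u = k.+2%:R * u - u.
  by rewrite -[in RHS]natr1 mulrDl mul1r addrK.
by rewrite sinB sinD; ring.
Qed.

(* The objects below that are characterized as "the unique solution of ..." are
   introduced by the choice operator [get], applied to the set of solutions. *)

Definition x0' n : R :=
  get [set x : R | cos (2 * pi / n%:R) < x < cos (pi / n%:R) /\
                   (chebU n.-1)^`().[x] = 0].

Definition Nmin n : R := `|(chebU n.-1).[x0' n]|.

Definition sinh_ratio n v : R :=
  if v == 0 then n%:R else sinh (n%:R * v) / sinh v.

Definition v0 n N : R := get [set v : R | 0 <= v /\ sinh_ratio n v = N].

Definition x0 n N : R :=
  get [set x : R | [/\ -1 < x < 1, 0 < x & `|(chebU n.-1).[x]| = N]].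

Definition u0 n N : R := if N == n%:R then 0 else acos (x0 n N).

(* R(n, N) *)
Definition urange n N : set R :=
  [set u : R | if n%:R < N then - pi <= u <= pi
               else u0 n N <= `|u| <= pi - u0 n N].

Definition transc_eq n N u v : Prop :=
  sinh (n%:R * v) ^+ 2 - N ^+ 2 * sinh v ^+ 2 =
  N ^+ 2 * sin u ^+ 2 - sin (n%:R * u) ^+ 2.

(* v(n, N, u): for N > n the root is taken in ]0, +oo[ (v = 0 is also a root
   when u is 0, pi or -pi), and for N <= n in [0, +oo[. *)
Definition vsol n N u : R :=
  if n%:R < N then get [set v : R | 0 < v /\ transc_eq n N u v]
  else get [set v : R | 0 <= v /\ transc_eq n N u v].

End RealAuxiliaries.

Section ComplexAuxiliaries.
Variable R : realType.
Implicit Types (n : nat) (N u : R).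

Definition cexp (z : R[i]) : R[i] :=
  let: x +i* y := z in (expR x)%:C * (cos y +i* sin y).

Definition csin (z : R[i]) : R[i] :=
  (cexp ('i%C * z) - cexp (- ('i%C * z))) / (2 * 'i%C).

Definition ccos (z : R[i]) : R[i] :=
  (cexp ('i%C * z) + cexp (- ('i%C * z))) / 2.

(* The quotient F / G at z, a value of the form 0 / 0 being understood as the
   limit at z.  The alias ^o gives R[i] its topology of normed field. *)
Definition quot (F G : R[i]^o -> R[i]^o) (z : R[i]^o) : R[i] :=
  if (F z == 0) && (G z == 0) then lim (F w / G w @[w --> z^'])
  else F z / G z.

Definition mu n N u : R[i] := u +i* vsol n N u.

Definition f1 n N u : R[i] :=
  quot (fun w => csin (n.+1%:R * w / 2)) (fun w => csin (n.-1%:R * w / 2))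
    (mu n N u).

Definition b1 n N u : R[i] := - quot (fun w => csin (n%:R * w)) csin (mu n N u).

Definition f2 n N u : R[i] :=
  quot (fun w => ccos (n.+1%:R * w / 2)) (fun w => ccos (n.-1%:R * w / 2))
    (mu n N u).

Definition b2 n N u : R[i] := quot (fun w => csin (n%:R * w)) csin (mu n N u).

End ComplexAuxiliaries.

(* Main.v *)
Require Import Defs.
From HB Require Import structures.
From mathcomp Require Import all_boot all_order all_algebra.
From mathcomp Require Import complex ring lra.
From mathcomp Require Import all_classical all_reals all_analysis.

Import Order.TTheory GRing.Theory Num.Theory.
Import numFieldNormedType.Exports.

(** An eigenvector of K_n(rho) for a nonzero eigenvalue lambda is a sampled
standing wave. If x_{j+1} + x_{j-1} = 2 c x_j, with x continued to the indices 0
and n + 1 by x_0 = rho x_1 and x_{n+1} = rho x_n, then the partial sums of a row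
of K_n(rho) x telescope ([KMS_wave]) and give (1 - 2 rho c + rho^2) K_n(rho) x =
(1 - rho^2) x. Conversely, if rho is nonzero every such eigenvector is a wave
([eigenvector_mode]). Write c = cos mu, which is possible for every complex c
with mu = u + i v, |u| <= pi and v >= 0 ([ccos_surj]). The waves of given parity
under j -> n + 1 - j form a line ([casoratian]), spanned by sin ((j - (n+1)/2)
mu) or cos ((j - (n+1)/2) mu); so the boundary condition x_{n+1} = rho x_n says
exactly that rho is the quotient f(mu), and the identity above then becomes
lambda = b(mu). When mu is 0 or +-pi the sampled wave may vanish at both ends;
its derivative in mu then takes its place, in agreement with the removal of the
singularity of f. The two parities are treated at once, by abstracting the pair
(sin, cos) or (cos, sin) into a pair of functions with the addition formulas
([curve_mode]).

On the other hand |sin (u + i v)|^2 = sin^2 u + sinh^2 v, so |b(mu)| = N is the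
equation sinh^2 (n v) - N^2 sinh^2 v = N^2 sin^2 u - sin^2 (n u), and the claims
on its roots say that the curve is parametrized by u. The left side is sinh^2 v
((sinh (n v) / sinh v)^2 - N^2); since sinh (n v) / sinh v increases from n to
infinity, this is increasing and unbounded as soon as the second factor is
nonnegative ([excess_lt], [excess_surj]). For |u| <= pi the right side is
nonnegative exactly on R(n, N), up to its zeros with sin u = 0: for N > n
because |sin (n u)| <= n |sin u|, and for N <= n because |sin (n u)| / sin u
decreases from n on the first lobe [0, pi/n] ([mulratio_cos_lt]) and is at most
N_min on the others ([Nmin_left]). The strict inequality N > N_min >= 1 also
excludes rho = 0 and the zeros of the denominator of f at which its numerator
does not vanish, since |lambda| = 1 there. *)

Set Implicit Arguments.
Unset Strict Implicit.
Unset Printing Implicit Defensive.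

Local Open Scope classical_set_scope.
Local Open Scope ring_scope.
Local Open Scope complex_scope.

(** * The quotients s (k v) / s v and the hyperbolic side *)

(** The quotient s (k v) / s v for a pair (s, c) with s (x + y) = s x c y + c x s y,
written without division: it makes sense, and is continuous, at the zeros of s.
The pairs (sinh, cosh), (sin, cos) and the complex (sin, cos) all use it. *)
Fixpoint mulratio (T : comPzRingType) (c : T -> T) (k : nat) (v : T) : T :=
  if k is k'.+1 then mulratio c k' v * c v + c (k'%:R * v) else 0.

Lemma mulratioE (T : comPzRingType) (s c : T -> T) k v :
    s 0 = 0 -> (forall x y, s (x + y) = s x * c y + c x * s y) ->
  s (k%:R * v) = mulratio c k v * s v.
Proof.
move=> s0 sD; elim: k => [|k IH]; first by rewrite !mul0r.
by rewrite -natr1 mulrDl mul1r sD IH /=; ring.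
Qed.

Lemma mulratio0 (T : comPzRingType) (c : T -> T) k : c 0 = 1 -> mulratio c k 0 = k%:R.
Proof.
by move=> c0; elim: k => //= k ->; rewrite mulr0 c0 mulr1 natr1.
Qed.

Lemma mulratio_continuous (K : numFieldType) (c : K -> K) k :
  continuous c -> continuous (mulratio c k).
Proof.
move=> cc; elim: k => [|k IH] x; first exact: (@cst_continuous K K 0).
rewrite (_ : mulratio c k.+1 = fun v => mulratio c k v * c v + c (k%:R * v))//.
have h : {for x, continuous (fun v : K => c (k%:R * v))}.
  apply: (@continuous_comp _ _ _ (fun v : K => k%:R * v) c); last exact: cc.
  exact: mulrl_continuous.
exact: (@continuousD K K K _ _ x (@continuousM K K _ _ x (IH x) (cc x)) h).
Qed.

Section Hyperbolic.
Variable R : realType.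
Implicit Types (x y v N : R).

Definition cosh v : R := (expR v + expR (- v)) / 2.

Lemma sinh0 : sinh 0 = 0 :> R.
Proof. by rewrite /sinh oppr0 subrr mul0r. Qed.

Lemma cosh0 : cosh 0 = 1.
Proof. by rewrite /cosh oppr0 expR0; field. Qed.

Lemma sinhD x y : sinh (x + y) = sinh x * cosh y + cosh x * sinh y.
Proof. by rewrite /sinh /cosh opprD !expRD; field. Qed.

Lemma cosh2Bsinh2 v : cosh v ^+ 2 - sinh v ^+ 2 = 1.
Proof.
have e : expR v * expR (- v) = 1 by rewrite -expRD subrr expR0.
rewrite /cosh /sinh -[RHS]e; by field.
Qed.

Lemma sinhN v : sinh (- v) = - sinh v.
Proof. by rewrite /sinh opprK -mulNr opprB. Qed.

Lemma coshN v : cosh (- v) = cosh v.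
Proof. by rewrite /cosh opprK addrC. Qed.

Lemma ltr_sinh : {mono (@sinh R) : x y / x < y}.
Proof.
apply: leW_mono; apply: le_mono => x y xy; rewrite /sinh.
have h1 : expR x < expR y by rewrite ltr_expR.
have h2 : expR (- y) < expR (- x) by rewrite ltr_expR ltrN2.
lra.
Qed.

Lemma sinh_gt0 v : (0 < sinh v) = (0 < v).
Proof. by rewrite -{1}sinh0 ltr_sinh. Qed.

Lemma sinh_eq0 v : (sinh v == 0) = (v == 0).
Proof.
apply/eqP/eqP => [h|->]; last exact: sinh0.
case: (ltgtP v 0) => // hv.
- by move: hv; rewrite -oppr_gt0 -sinh_gt0 sinhN h oppr0 ltxx.
- by move: hv; rewrite -sinh_gt0 h ltxx.
Qed.

Lemma ltr_cosh x y : 0 <= x -> x < y -> cosh x < cosh y.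
Proof.
move=> x0 xy; rewrite /cosh.
have hx : 1 <= expR x by rewrite -expR0 ler_expR.
have hxy : expR x < expR y by rewrite ltr_expR.
have ex : expR x * expR (- x) = 1 by rewrite -expRD subrr expR0.
have ey : expR y * expR (- y) = 1 by rewrite -expRD subrr expR0.
have py := expR_gt0 (- y).
have ley : expR (- y) < 1 by rewrite -expR0 ltr_expR oppr_lt0; lra.
have lex : expR (- x) <= 1 by rewrite -expR0 ler_expR oppr_le0.
have -> : expR y = expR x + (expR y - expR x) by ring.
have -> : expR (- x) = expR (- y) + (expR y - expR x) * expR (- x) * expR (- y).
  by transitivity (expR (-y) * (1 - expR x * expR (-x)) + expR y * expR (-y) * expR (-x));
    [rewrite ey ex; ring | ring].
have : expR (- x) * expR (- y) < 1.
  by rewrite (le_lt_trans _ ley)// ler_piMl// ltW.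
nra.
Qed.

Lemma cosh_ge1 v : 1 <= cosh v.
Proof.
rewrite -cosh0; case: (ltgtP v 0) => [h|h|->] //.
- by rewrite -[leRHS]coshN ltW// ltr_cosh// oppr_gt0.
- by rewrite ltW// ltr_cosh.
Qed.

Lemma cosh_ge0 v : 0 <= cosh v.
Proof. exact: le_trans (cosh_ge1 v). Qed.

Lemma sinh_continuous : continuous (@sinh R).
Proof.
move=> x; apply: cvgMr_tmp; apply: cvgB; first exact: continuous_expR.
apply: (@continuous_comp _ _ _ (fun v : R => - v) expR).
  exact: opp_continuous.
exact: continuous_expR.
Qed.

Lemma cosh_continuous : continuous cosh.
Proof.
move=> x; apply: cvgMr_tmp; apply: cvgD; first exact: continuous_expR.
apply: (@continuous_comp _ _ _ (fun v : R => - v) expR).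
  exact: opp_continuous.
exact: continuous_expR.
Qed.

Lemma sinh_ratioE n v : sinh_ratio n v = mulratio cosh n v.
Proof.
rewrite /sinh_ratio; case: eqP => [->|/eqP v0]; first by rewrite mulratio0// cosh0.
by rewrite (mulratioE n v sinh0 sinhD) mulfK// sinh_eq0.
Qed.

Lemma mulratio_cosh_ge0 n v : 0 <= mulratio cosh n v.
Proof.
elim: n => //= n IH.
by rewrite addr_ge0// ?mulr_ge0// (le_trans _ (cosh_ge1 _)).
Qed.

(** Every step of the recursion is increasing in v >= 0 because cosh is. *)
Lemma mulratio_cosh_le n x y : 0 <= x -> x < y -> mulratio cosh n x <= mulratio cosh n y.
Proof.
move=> x0 xy; elim: n => //= n IH; apply: lerD.
  by apply: ler_pM; rewrite ?mulratio_cosh_ge0 ?cosh_ge0//; apply/ltW/ltr_cosh.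
case: n {IH} => [|n]; first by rewrite !mul0r.
by rewrite ltW// ltr_cosh// ?mulr_ge0// ltr_pM2l// ltr0n.
Qed.

Lemma mulratio_cosh_lt n x y : (1 < n)%N -> 0 <= x -> x < y ->
  mulratio cosh n x < mulratio cosh n y.
Proof.
case: n => [//|[//|n]] _ x0 xy; rewrite [ltLHS]/= [ltRHS]/=.
apply: ler_ltD.
  apply: (@ler_pM _ (mulratio cosh n.+1 x)) => //.
  - exact: mulratio_cosh_ge0.
  - exact: cosh_ge0.
  - exact: mulratio_cosh_le.
  - by rewrite ltW// ltr_cosh.
by rewrite ltr_cosh// ?mulr_ge0// ltr_pM2l// ltr0n.
Qed.

Lemma mulratio_cosh_unbounded n N v : (1 < n)%N -> 0 <= N -> 2 * N <= v ->
  N <= mulratio cosh n v.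
Proof.
move=> n1 N0 hv; have v0 : 0 <= v by lra.
apply: (@le_trans _ _ (cosh v)).
  rewrite /cosh; have := expR_ge1Dx v; have := expR_gt0 (- v); lra.
case: n n1 => [//|[//|n]] _; elim: n => [|n IH].
  by rewrite /= !mul0r !add0r cosh0 mul1r ler_wpDr// (le_trans _ (cosh_ge1 _)).
rewrite (_ : mulratio _ n.+3 _ = mulratio cosh n.+2 v * cosh v + cosh (n.+2%:R * v))//.
rewrite ler_wpDr ?cosh_ge0// ler_peMl ?cosh_ge0//.
exact: le_trans (cosh_ge1 v) IH.
Qed.

(** The left side of the transcendental equation. *)
Definition excess n N v := sinh (n%:R * v) ^+ 2 - N ^+ 2 * sinh v ^+ 2.

Lemma excessE n N v : excess n N v = sinh v ^+ 2 * (mulratio cosh n v ^+ 2 - N ^+ 2).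
Proof. by rewrite /excess (mulratioE n v sinh0 sinhD); ring. Qed.

(** In sinh^2 v (r(v)^2 - N^2) with r(v) = sinh (n v) / sinh v both factors increase,
and the second is nonnegative from the point where r reaches N. *)
Lemma excess_lt n N x y : (1 < n)%N -> 0 <= N -> 0 <= x -> x < y ->
  N <= mulratio cosh n x -> excess n N x < excess n N y.
Proof.
move=> n1 N0 x0 xy hN; rewrite !excessE.
have hr := mulratio_cosh_lt n1 x0 xy.
have hs : 0 <= sinh x < sinh y.
  rewrite ltr_sinh xy andbT; move: x0; rewrite le_eqVlt => /predU1P[<-|].
    by rewrite sinh0.
  by rewrite -sinh_gt0 => /ltW.
move: hs => /andP[s0 s1].
have h1 : sinh x ^+ 2 < sinh y ^+ 2 by rewrite ltrXn2r.
have h2 : mulratio cosh n x ^+ 2 < mulratio cosh n y ^+ 2.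
  by rewrite ltrXn2r ?mulratio_cosh_ge0.
have h3 : N ^+ 2 <= mulratio cosh n x ^+ 2.
  by rewrite lerXn2r ?nnegrE ?mulratio_cosh_ge0.
have h0 : 0 <= sinh x ^+ 2 by rewrite sqr_ge0.
nra.
Qed.

Lemma excess_continuous n N : continuous (excess n N).
Proof.
move=> x.
have c2 : {for x, continuous (fun v => mulratio cosh n v ^+ 2 - N ^+ 2)}.
  apply: cvgB; last exact: cvg_cst.
  apply: (@continuous_comp _ _ _ (mulratio cosh n) (fun t => t ^+ 2)).
    exact: (@mulratio_continuous R cosh n cosh_continuous).
  exact: exprn_continuous.
have c1 : {for x, continuous (fun v => sinh v ^+ 2)}.
  apply: (@continuous_comp _ _ _ (@sinh R) (fun t => t ^+ 2)).
    exact: sinh_continuous.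
  exact: exprn_continuous.
rewrite (_ : excess n N = fun v => sinh v ^+ 2 * (mulratio cosh n v ^+ 2 - N ^+ 2)).
  exact: cvgM.
by apply/funext => v; rewrite excessE.
Qed.

Lemma excess_surj n N a T : (1 < n)%N -> 0 <= N -> 0 <= a ->
    N <= mulratio cosh n a -> excess n N a <= T ->
  exists2 v, a <= v & excess n N v = T.
Proof.
move=> n1 N0 a0 ha hT.
(* e^b >= 1 + b makes both sinh b and the quotient at least b / 2. *)
pose b := a + 2 * (N + 1 + `|T|).
have T0 : 0 <= `|T| by [].
have TT : T <= `|T| := ler_norm T.
have ab : a <= b by rewrite /b; lra.
have hb : T <= excess n N b.
  have h1 : N + 1 <= mulratio cosh n b.
    by apply: mulratio_cosh_unbounded => //; rewrite /b; lra.
  have h2 : 1 + `|T| <= sinh b.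
    have b0 : expR (- b) <= 1 by rewrite -expR0 ler_expR oppr_le0; lra.
    have := expR_ge1Dx b; rewrite /sinh /b in b0 *; lra.
  have h3 : 1 <= mulratio cosh n b ^+ 2 - N ^+ 2 by nra.
  rewrite excessE; have h4 : `|T| <= sinh b ^+ 2 by nra.
  nra.
have [||v] := @IVT R (excess n N) a b T ab.
- exact: continuous_subspaceT (@excess_continuous n N).
- by rewrite ge_min hT le_max hb orbT.
- by rewrite in_itv /= => /andP[av _] <-; exists v.
Qed.

Lemma mulratio_cosh_surj n N : (1 < n)%N -> n%:R <= N ->
  exists2 v, 0 <= v & mulratio cosh n v = N.
Proof.
move=> n1 nN; have N0 : 0 <= N by rewrite (le_trans _ nN).
pose b := 2 * N; have b0 : 0 <= b by rewrite mulr_ge0.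
have [||v] := @IVT R (mulratio cosh n) 0 b N b0.
- apply: continuous_subspaceT.
  exact: (@mulratio_continuous R cosh n cosh_continuous).
- by rewrite mulratio0 ?cosh0// ge_min nN le_max mulratio_cosh_unbounded ?orbT.
- by rewrite in_itv /= => /andP[v0 _] <-; exists v.
Qed.

End Hyperbolic.

(** * The lobes of sin (n u) / sin u *)

Section Circular.
Variable R : realType.
Implicit Types (u w x y N : R) (n k : nat).

Lemma sin_mulE n u : sin (n%:R * u) = mulratio cos n u * sin u.
Proof. exact: (mulratioE n u (@sin0 R) (@sinD R)). Qed.

Lemma mulratio_cos0 n : mulratio (@cos R) n 0 = n%:R.
Proof. by rewrite mulratio0// cos0. Qed.

Lemma sin_mul_le n u : `|sin (n%:R * u)| <= n%:R * `|sin u|.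
Proof.
rewrite sin_mulE normrM ler_wpM2r//; elim: n => [|n IH] /=; first by rewrite normr0.
rewrite -natr1 (le_trans (ler_normD _ _))// lerD ?cos_max// normrM.
by rewrite -[leRHS]mulr1 ler_pM ?cos_max.
Qed.

Lemma chebU_ratio n u : sin u != 0 -> (0 < n)%N ->
  (chebU R n.-1).[cos u] = mulratio cos n u.
Proof.
move=> su n0; apply: (mulIf su).
by rewrite chebU_cos prednK// sin_mulE.
Qed.

(** The derivative of U_k (cos u) sin u = sin ((k+1) u), multiplied by sin u.  It
identifies the critical points of U_{n-1} with those of sin (n u) / sin u. *)
Lemma chebU_deriv_cos k u : (chebU R k)^`().[cos u] * sin u ^+ 3 =
  sin (k.+1%:R * u) * cos u - k.+1%:R * cos (k.+1%:R * u) * sin u.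
Proof.
pose P k := (chebU R k)^`().[cos u] * sin u ^+ 3 =
  sin (k.+1%:R * u) * cos u - k.+1%:R * cos (k.+1%:R * u) * sin u.
suff [] : P k /\ P k.+1 by [].
have e2 : 2 * u = u + u by ring.
elim: k => [|k [IH1 IH2]]; split => //; rewrite /P.
- by rewrite /= derivC horner0 !mul1r; ring.
- have -> : (chebU R 1)^`().[cos u] = 2.
    by rewrite /= derivM derivC derivX !hornerE.
  by rewrite e2 sinD cosD; ring.
have -> : (chebU R k.+2)^`().[cos u] = 2 * (chebU R k.+1).[cos u] +
    2 * cos u * (chebU R k.+1)^`().[cos u] - (chebU R k)^`().[cos u].
  rewrite [chebU R k.+2]/= derivB derivM derivM derivC derivX.
  by rewrite !(hornerE, hornerM, hornerD, hornerN); ring.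
transitivity (2 * sin u ^+ 2 * ((chebU R k.+1).[cos u] * sin u)
  + 2 * cos u * ((chebU R k.+1)^`().[cos u] * sin u ^+ 3)
  - (chebU R k)^`().[cos u] * sin u ^+ 3); first by ring.
rewrite chebU_cos (IH1 : _ = _) IH2.
have -> : k.+3%:R * u = k.+2%:R * u + u by rewrite -[in LHS]natr1 mulrDl mul1r.
have -> : k.+1%:R * u = k.+2%:R * u - u.
  by rewrite -[in RHS]natr1 mulrDl mul1r addrK.
have -> : k.+3%:R = k.+2%:R + 1 :> R by rewrite natr1.
have -> : k.+1%:R = k.+2%:R - 1 :> R by rewrite -[in RHS]natr1 addrK.
by rewrite sinB cosB sinD cosD; ring.
Qed.

Lemma sin_gt0_itv u : 0 < u -> u < pi -> 0 < sin u.
Proof. by move=> u0 u1; rewrite sin_gt0_pi// u0. Qed.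

(** As for cosh: on [0, pi/(k+1)] both cos u and cos (k u) decrease, cos u is
nonnegative, and so is the quotient for k.  For n = 1 the quotient is constant,
which is the case of equality. *)
Lemma mulratio_cos_decr n : (0 < n)%N ->
  forall x y, 0 <= x -> x < y -> y <= pi / n%:R ->
  mulratio cos n y <= mulratio cos n x ?= iff (n == 1)%N.
Proof.
have p0 := pi_gt0 R.
case: n => // n _; elim: n => [|n IH] x y x0 xy yn.
  by rewrite /= !mul0r !add0r cos0; apply/leif_refl.
have nn : 0 < n.+1%:R :> R by rewrite ltr0n.
have nn2 : 0 < n.+2%:R :> R by rewrite ltr0n.
have y1 : y * n.+2%:R <= pi by rewrite -ler_pdivlMr.
have n2E : n.+2%:R = n.+1%:R + 1 :> R by rewrite natr1.
have n1E : n.+1%:R = n%:R + 1 :> R by rewrite natr1.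
have nge : 0 <= n%:R :> R by rewrite ler0n.
have y2 : n.+1%:R * y <= pi by rewrite n2E in y1; nra.
have y3 : y <= pi / 2.
  rewrite n2E n1E in y1; nra.
have r0 : 0 <= mulratio cos n.+1 y.
  have sy : 0 < sin y by rewrite sin_gt0_itv //; lra.
  rewrite -(pmulr_lge0 _ sy) -sin_mulE sin_ge0_pi// y2 andbT.
  by rewrite mulr_ge0// ltW//; lra.
have [IH1 _] : mulratio cos n.+1 y <= mulratio cos n.+1 x ?= iff (n.+1 == 1)%N.
  by apply: IH => //; rewrite ler_pdivlMr// mulrC.
have c1 : cos y < cos x.
  by rewrite ltr_cos// in_itv /=; lra.
have c2 : cos (n.+1%:R * y) < cos (n.+1%:R * x).
  rewrite ltr_cos ?ltr_pM2l// in_itv /= ?y2 ?andbT ?mulr_ge0//; last by lra.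
  by nra.
have c3 : 0 <= cos y by rewrite cos_ge0_pihalf//; lra.
suff h : mulratio cos n.+2 y < mulratio cos n.+2 x.
  by split; [exact: ltW | rewrite (lt_eqF h)].
rewrite [ltLHS]/= [ltRHS]/=; apply: ler_ltD => //.
by rewrite ler_pM// ltW.
Qed.

Lemma mulratio_cos_lt n x y : (1 < n)%N -> 0 <= x -> x < y -> y <= pi / n%:R ->
  mulratio cos n y < mulratio cos n x.
Proof.
move=> n1 x0 xy yn; have [h1 h2] := mulratio_cos_decr (ltnW n1) x0 xy yn.
by rewrite lt_neqAle h1 h2 andbT; case: n n1 {yn h1 h2} => [|[]].
Qed.

End Circular.

Section Lobes.
Variables (R : realType) (n : nat).
Hypothesis hn : (3 <= n)%N.
Implicit Types (u w x y N : R) (k : nat).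

Let size_facts : [/\ (0 < n)%N, @Order.le _ R 3 n%:R, @Order.lt _ R 0 n%:R
  & @Order.lt _ R 0 pi].
Proof.
have n3 : 3 <= n%:R :> R by rewrite (ler_nat R 3).
by split; [exact: leq_trans hn | | lra | exact: pi_gt0].
Qed.

(** Up to the factor sin^2 u, the derivative of sin (n u) / sin u. *)
Let h u := n%:R * cos (n%:R * u) * sin u - sin (n%:R * u) * cos u.

Lemma lobe_bounds u : pi / n%:R <= u <= 2 * pi / n%:R -> 0 < u < pi.
Proof.
have [nn0 n3 n0 p0] := size_facts.
rewrite ler_pdivrMr// ler_pdivlMr// => /andP[u1 u2]; apply/andP; split; nra.
Qed.

Lemma lobe_sin_lt0 u : pi / n%:R < u < 2 * pi / n%:R -> sin (n%:R * u) < 0.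
Proof.
have [nn0 n3 n0 p0] := size_facts.
rewrite ltr_pdivrMr// ltr_pdivlMr// => /andP[u1 u2].
have -> : n%:R * u = (n%:R * u - pi) + pi by ring.
by rewrite sinDpi oppr_lt0 sin_gt0_itv//; nra.
Qed.

Let h_derive u : is_derive u 1 h ((1 - n%:R ^+ 2) * sin (n%:R * u) * sin u).
Proof. by apply: is_derive_eq; rewrite /GRing.scale /=; ring. Qed.

Let h_cont : continuous h.
Proof.
have [nn0 n3 n0 p0] := size_facts.
move=> u; apply/differentiable_continuous/derivable1_diffP.
exact: (@ex_derive _ _ _ _ _ _ _ (h_derive u)).
Qed.

(** h' = (1 - n^2) sin (n u) sin u is positive inside the second lobe, where sin (n u)
is negative.  So the critical point there is unique. *)
Let h_incr x y : pi / n%:R <= x -> x < y -> y <= 2 * pi / n%:R -> h x < h y.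
Proof.
have [nn0 n3 n0 p0] := size_facts.
move=> hx xy hy; rewrite -subr_gt0.
have [|c] := @MVT R h _ x y xy (fun u _ => h_derive u).
  exact: continuous_subspaceT.
rewrite in_itv /= => /andP[c1 c2] ->.
have l : sin (n%:R * c) < 0.
  by apply: lobe_sin_lt0; rewrite (le_lt_trans hx c1) (lt_le_trans c2 hy).
have /andP[c3 c4] : 0 < c < pi by apply: lobe_bounds; lra.
have s := sin_gt0_itv c3 c4.
by rewrite mulr_gt0 ?subr_gt0// mulr_gt0// nmulr_lgt0//; nra.
Qed.

(** The choice made in N_min has a candidate, because h changes sign on the second
lobe. *)
Lemma x0'_lobe : exists2 w, pi / n%:R < w < 2 * pi / n%:R & x0' R n = cos w /\ h w = 0.
Proof.
have [nn0 n3 n0 p0] := size_facts.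
have q : 0 < pi / n%:R :> R by rewrite divr_gt0.
have l12 : pi / n%:R < 2 * pi / n%:R :> R by rewrite -mulrA ltr_pMl// (ltr_nat R 1).
have e1 : n%:R * (pi / n%:R) = pi :> R by field; exact: lt0r_neq0.
have e2 : n%:R * (2 * pi / n%:R) = pi *+ 2 :> R by rewrite -mulr_natl; field; exact: lt0r_neq0.
have b1 := @lobe_bounds (pi / n%:R) (introT andP (conj (lexx _) (ltW l12))).
have b2 := @lobe_bounds (2 * pi / n%:R) (introT andP (conj (ltW l12) (lexx _))).
have s1 : 0 < sin (pi / n%:R) :> R by apply: sin_gt0_pi.
have s2 : 0 < sin (2 * pi / n%:R) :> R by apply: sin_gt0_pi.
have h1 : h (pi / n%:R) < 0 by rewrite /h e1 cospi sinpi; nra.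
have h2 : 0 < h (2 * pi / n%:R) by rewrite /h e2 cos2pi sin2pi; nra.
have [x] : [set x | cos (2 * pi / n%:R) < x < cos (pi / n%:R) /\
                   (chebU R n.-1)^`().[x] = 0] !=set0.
  have [||w] := @IVT R h _ _ 0 (ltW l12).
  - exact: continuous_subspaceT.
  - by rewrite ge_min (ltW h1) le_max (ltW h2) orbT.
  rewrite in_itv /= => /andP[w1 w2] hw.
  have {}w1 : pi / n%:R < w.
    by rewrite lt_neqAle w1 andbT; apply/eqP => e; rewrite e hw ltxx in h1.
  have {}w2 : w < 2 * pi / n%:R.
    by rewrite lt_neqAle w2 andbT; apply/eqP => e; rewrite -e hw ltxx in h2.
  have /andP[w3 w4] : 0 < w < pi by apply: lobe_bounds; lra.
  exists (cos w); split.
    by rewrite !ltr_cos ?w1 ?w2// in_itv /=; lra.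
  have s := sin_gt0_itv w3 w4.
  have s3 : sin w ^+ 3 != 0 by rewrite expf_neq0// gt_eqF.
  apply: (mulIf s3); rewrite mul0r chebU_deriv_cos prednK//.
  by rewrite -[RHS]oppr0 -hw /h opprB.
move=> /(@getI _ _) []; rewrite -/(x0' R n) => /andP[x1 x2] hx.
have x3 := @cos_geN1 R (2 * pi / n%:R); have x4 := @cos_le1 R (pi / n%:R).
have xI : x0' R n \in `[(-1), 1] by rewrite in_itv /=; lra.
have xI' : -1 <= x0' R n <= 1 by [].
have eK := acosK xI.
have a0 := acos_ge0 xI'; have a1 := acos_lepi xI'.
rewrite -eK in x1 x2 hx.
rewrite ltr_cos ?in_itv/= ?a0 ?a1// in x1; last by lra.
rewrite ltr_cos ?in_itv/= ?a0 ?a1// in x2; last by lra.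
exists (acos (x0' R n)); first by rewrite x1 x2.
split; first by rewrite eK.
have := chebU_deriv_cos n.-1 (acos (x0' R n)).
by rewrite hx mul0r prednK// => /esym/eqP; rewrite subr_eq0 /h => /eqP ->; rewrite subrr.
Qed.

(** On the second lobe sin (n u) / sin u is nonpositive, decreases up to the zero of
h and increases after it. *)
Lemma Nmin_lobe u : pi / n%:R <= u <= 2 * pi / n%:R ->
  `|sin (n%:R * u)| <= Nmin R n * sin u.
Proof.
have [nn0 n3 n0 p0] := size_facts.
move=> hu; have [w /andP[w1 w2] [xw hw]] := x0'_lobe.
have /andP[w3 w4] : 0 < w < pi by apply: lobe_bounds; lra.
have sw := sin_gt0_itv w3 w4.
have /andP[u3 u4] := lobe_bounds hu.
have su := sin_gt0_itv u3 u4.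
rewrite /Nmin xw chebU_ratio// ?gt_eqF// sin_mulE normrM (gtr0_norm su) ler_pM2r//.
pose s v := sin (n%:R * v) / sin v : R.
have sE v : 0 < sin v -> mulratio cos n v = s v.
  by move=> sv; rewrite /s sin_mulE mulfK// gt_eqF.
have s_le0 v : pi / n%:R <= v <= 2 * pi / n%:R -> s v <= 0.
  move=> hv; have /andP[v1 v2] := lobe_bounds hv.
  rewrite pmulr_lle0 ?invr_gt0 ?sin_gt0_itv//.
  move/andP: hv => [+ +]; rewrite le_eqVlt => /predU1P[<- _|v3].
    by rewrite (_ : _ * _ = pi) ?sinpi//; field; exact: lt0r_neq0.
  rewrite le_eqVlt => /predU1P[->|v4].
    by rewrite (_ : _ * _ = pi *+ 2) ?sin2pi// -mulr_natl; field; exact: lt0r_neq0.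
  by rewrite ltW// lobe_sin_lt0// v3 v4.
rewrite !sE// !ler0_norm ?s_le0// ?(ltW w1) ?(ltW w2)// lerN2.
have sd v : 0 < sin v -> is_derive v 1 s (h v / sin v ^+ 2).
  move=> sv; have sv0 : sin v != 0 by rewrite gt_eqF.
  by apply: is_derive_eq; rewrite /GRing.scale /= /h; field.
have spos (v : R) : pi / n%:R <= v <= 2 * pi / n%:R -> 0 < sin v.
  by move=> hv; apply/sin_gt0_pi/lobe_bounds.
have mvt x y : pi / n%:R <= x -> x < y -> y <= 2 * pi / n%:R ->
    exists2 c, x < c < y & s y - s x = h c / sin c ^+ 2 * (y - x).
  move=> hx xy hy; have [||c] := @MVT R s (fun v => h v / sin v ^+ 2) x y xy.
  - by move=> v; rewrite in_itv/= => /andP[v1 v2]; apply/sd/spos; lra.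
  - apply: derivable_within_continuous => v.
    rewrite in_itv/= => /andP[v1 v2].
    by have [] := sd v; first (by apply: spos; lra).
  by rewrite in_itv/= => cI ->; exists c.
move/andP: hu => [hu1 hu2].
have [uw|wu|->//] := ltgtP u w.
- have [c /andP[c1 c2] e] := mvt u w hu1 uw (ltW w2).
  have hc : h c < 0 by rewrite -hw; apply: h_incr => //; lra.
  rewrite -subr_le0 e pmulr_lle0 ?subr_gt0// pmulr_lle0 ?(ltW hc)//.
  by rewrite invr_gt0 exprn_gt0// spos//; lra.
- have [c /andP[c1 c2] e] := mvt w u (ltW w1) wu hu2.
  have hc : 0 < h c by rewrite -hw; apply: h_incr => //; lra.
  rewrite -subr_ge0 e pmulr_lge0 ?subr_gt0// pmulr_lge0 ?(ltW hc)//.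
  by rewrite invr_gt0 exprn_gt0// spos//; lra.
Qed.

(** At the middle 3 pi / (2 n) of the second lobe |sin (n u)| = 1. *)
Lemma Nmin_ge1 : 1 <= Nmin R n.
Proof.
have [nn0 n3 n0 p0] := size_facts.
pose u : R := 3 * pi / (2 * n%:R).
have hu : pi / n%:R <= u <= 2 * pi / n%:R.
  have uE : u * n%:R = 3 * pi / 2 by rewrite /u; field; exact: lt0r_neq0.
  by rewrite ler_pdivrMr// ler_pdivlMr// uE; apply/andP; split; lra.
have := Nmin_lobe hu.
have -> : n%:R * u = pi / 2 + pi by rewrite /u; field; exact: lt0r_neq0.
rewrite sinDpi sin_pihalf normrN normr1 => /le_trans; apply.
by rewrite ler_piMr ?sin_le1// /Nmin.
Qed.

(** A shift by pi/n to the left keeps |sin (n u)| and decreases sin u as long as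
u <= pi/2, so every later lobe is dominated by the second one. *)
Lemma Nmin_left u : pi / n%:R <= u <= pi / 2 -> `|sin (n%:R * u)| <= Nmin R n * sin u.
Proof.
have [nn0 n3 n0 p0] := size_facts.
move=> /andP[u1 u2].
(* The number of shifts that may be needed to reach the second lobe. *)
pose m := Num.truncn (u / (pi / n%:R)).
have : u <= pi / n%:R + m.+1%:R * (pi / n%:R).
  have q : 0 < pi / n%:R :> R by rewrite divr_gt0.
  have : u / (pi / n%:R) < m.+1%:R by apply: truncnS_gt.
  rewrite ltr_pdivrMr//; lra.
elim: m.+1 (u) u1 u2 => [|k IH] {m}{}u u1 u2 hk.
  apply: Nmin_lobe; rewrite u1/=; move: hk; rewrite mul0r addr0.
  have q : 0 < pi / n%:R :> R by rewrite divr_gt0.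
  lra.
have q : 0 < pi / n%:R :> R by rewrite divr_gt0.
have [ul|ul] := leP u (2 * pi / n%:R); first by apply: Nmin_lobe; rewrite u1.
pose u' := u - pi / n%:R.
have -> : n%:R * u = n%:R * u' + pi by rewrite /u'; field; exact: lt0r_neq0.
rewrite sinDpi normrN; apply: le_trans (IH u' _ _ _) _; rewrite /u'.
- lra.
- lra.
- by move: hk; rewrite -natr1; lra.
rewrite ler_pM2l; last by apply: lt_le_trans Nmin_ge1.
rewrite ltW// ltr_sin ?in_itv/=; lra.
Qed.

Lemma sin_mul_reflect u : `|sin (n%:R * (pi - u))| = `|sin (n%:R * u)|.
Proof.
have [nn0 n3 n0 p0] := size_facts.
have snpi : sin (n%:R * pi) = 0 :> R by rewrite sin_mulE sinpi mulr0.
rewrite mulrBr sinB snpi mul0r sub0r normrN normrM.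
by rewrite (sin0cos1 snpi) mul1r.
Qed.

Lemma sin_reflect u : sin (pi - u) = sin u.
Proof. by rewrite sinB sinpi cospi; ring. Qed.

Lemma u0_spec N : Nmin R n < N -> N < n%:R ->
  0 < u0 n N < pi / n%:R /\ mulratio cos n (u0 n N) = N.
Proof.
have [nn0 n3 n0 p0] := size_facts.
move=> N1 N2; have N3 := Nmin_ge1.
have q : 0 < pi / n%:R :> R by rewrite divr_gt0.
have q2 : pi / n%:R <= pi / 2 :> R.
  by rewrite ler_pM2l// lef_pV2 ?posrE//; lra.
have rq : mulratio cos n (pi / n%:R) = 0 :> R.
  have sq : 0 < sin (pi / n%:R) :> R by rewrite sin_gt0_itv//; lra.
  apply: (mulIf (lt0r_neq0 sq)).
  by rewrite -sin_mulE mul0r (_ : _ * _ = pi) ?sinpi//; field; exact: lt0r_neq0.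
have [x] : [set x : R | [/\ -1 < x < 1, 0 < x & `|(chebU R n.-1).[x]| = N]] !=set0.
  have [||w] := @IVT R (mulratio cos n) 0 (pi / n%:R) N (ltW q).
  - apply: continuous_subspaceT.
    exact: (@mulratio_continuous R cos n (@continuous_cos R)).
  - by rewrite rq mulratio_cos0 ge_min le_max (ltW N2) (_ : 0 <= N) ?orbT//; lra.
  rewrite in_itv/= => /andP[w1 w2] rw.
  have {}w1 : 0 < w.
    rewrite lt_neqAle w1 andbT; apply/eqP => e.
    by move: N2; rewrite -rw -e mulratio_cos0 ltxx.
  have {}w2 : w < pi / n%:R.
    rewrite lt_neqAle w2 andbT; apply/eqP => e.
    by move: N3 N1; rewrite -rw e rq; lra.
  have sw : 0 < sin w by rewrite sin_gt0_itv//; lra.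
  have cw : cos w < 1 by rewrite -cos0 ltr_cos// in_itv/=; lra.
  have cw0 : 0 < cos w by rewrite cos_gt0_pihalf//; lra.
  exists (cos w); split => //; first by lra.
  by rewrite chebU_ratio ?gt_eqF// rw ger0_norm//; lra.
move=> /(@getI _ _) []; rewrite -/(x0 n N) => /andP[x1 x2] x3 hx.
have xI : x0 n N \in `[(-1), 1] by rewrite in_itv /=; lra.
have eK := acosK xI.
rewrite /u0 lt_eqF//.
have a0 : 0 < acos (x0 n N) by rewrite acos_gt0//; lra.
have a1 : acos (x0 n N) <= pi by rewrite acos_lepi//; lra.
have a2 : acos (x0 n N) < pi / 2.
  by rewrite -ltr_cos ?in_itv/= ?cos_pihalf ?eK//; lra.
have sa : 0 < sin (acos (x0 n N)) by rewrite sin_gt0_itv//; lra.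
move: hx; rewrite -eK chebU_ratio ?gt_eqF// eK => hx.
have a3 : acos (x0 n N) < pi / n%:R.
  rewrite ltNge; apply/negP => a3.
  have /Nmin_left : pi / n%:R <= acos (x0 n N) <= pi / 2 by rewrite a3 ltW.
  rewrite sin_mulE normrM hx (gtr0_norm sa) ler_pM2r//; lra.
rewrite a0 a3; split => //.
rewrite -[RHS]hx ger0_norm// -rq ltW//; apply: mulratio_cos_lt => //; last exact: ltW.
by apply: leq_trans hn.
Qed.

Lemma sin_mul_le_urange N u : Nmin R n < N -> N <= n%:R ->
  urange n N u -> `|sin (n%:R * u)| <= N * `|sin u|.
Proof.
have [nn0 n3 n0 p0] := size_facts.
move=> N1; rewrite le_eqVlt => /predU1P[-> _|N2]; first exact: sin_mul_le.
rewrite /urange /= ltNge (ltW N2)/= => ur.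
have N3 := Nmin_ge1.
have [/andP[u1 u2] ru] := u0_spec N1 N2.
have q2 : pi / n%:R <= pi / 2 :> R.
  by rewrite ler_pM2l// lef_pV2 ?posrE//; lra.
have H u' : u0 n N <= u' <= pi - u0 n N -> `|sin (n%:R * u')| <= N * sin u'.
  wlog : u' / u' <= pi / 2.
    move=> W /andP[h1 h2]; have [h3|h3] := leP u' (pi / 2); first by rewrite W ?h1.
    by rewrite -(sin_mul_reflect u') -(sin_reflect u'); apply: W; lra.
  move=> h1 /andP[h2 h3]; have [h4|h4] := leP (pi / n%:R) u'.
    apply: (@le_trans _ _ (Nmin R n * sin u')); first by rewrite Nmin_left ?h4.
    by rewrite ler_wpM2r ?(ltW N1)// ltW// sin_gt0_itv//; lra.
  have su : 0 < sin u' by rewrite sin_gt0_itv//; lra.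
  rewrite sin_mulE normrM (gtr0_norm su) ler_pM2r// -ru.
  have r0 : 0 <= mulratio cos n u'.
    rewrite -(pmulr_lge0 _ su) -sin_mulE sin_ge0_pi//.
    move: h4; rewrite ltr_pdivlMr//; nra.
  rewrite ger0_norm//; move: h2; rewrite le_eqVlt => /predU1P[->//|h2].
  apply/ltW/mulratio_cos_lt => //; [by apply: leq_trans hn|exact: ltW|exact: ltW].
have := H _ ur; case: (leP 0 u) => [u3|u3].
  by rewrite (ger0_norm u3) => h1; rewrite (le_trans h1)// ler_wpM2l ?ler_norm//; lra.
rewrite (ltr0_norm u3) mulrN !sinN normrN => h1; rewrite (le_trans h1)// ler_wpM2l//.
  lra.
by rewrite -normrN ler_norm.
Qed.

Lemma urange_pi N u : Nmin R n < N -> urange n N u -> - pi <= u <= pi.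
Proof.
have [nn0 n3 n0 p0] := size_facts.
move=> N1; rewrite /urange/=; case: ltP => // nN h1.
have : 0 <= u0 n N.
  move: nN; rewrite le_eqVlt => /predU1P[->|N2]; first by rewrite /u0 eqxx.
  by have [/andP[/ltW]] := u0_spec N1 N2.
move/andP: h1 => [_ h2] h3; rewrite -ler_norml; lra.
Qed.

(** The converse of [sin_mul_le_urange]: outside R(n, N) the right side of the
transcendental equation is negative, except at the zeros of sin u. *)
Lemma notin_urange N u : Nmin R n < N -> N <= n%:R -> - pi <= u <= pi ->
  ~ urange n N u -> N < n%:R /\ (sin u = 0 \/ N * `|sin u| < `|sin (n%:R * u)|).
Proof.
have [nn0 n3 n0 p0] := size_facts.
move=> N1; rewrite le_eqVlt => /predU1P[->|N2] upi.
  by rewrite /urange/= ltxx /u0 eqxx normr_ge0 subr0/= ler_norml upi.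
rewrite /urange/= ltNge (ltW N2)/= => nr; split => //.
have N3 := Nmin_ge1.
have [/andP[u1 u2] ru] := u0_spec N1 N2.
have H u' : 0 < u' < u0 n N -> N * `|sin u'| < `|sin (n%:R * u')|.
  move=> /andP[h1 h2].
  have q2 : pi / n%:R <= pi / 2 :> R.
    by rewrite ler_pM2l// lef_pV2 ?posrE//; lra.
  have su : 0 < sin u' by rewrite sin_gt0_itv//; lra.
  rewrite sin_mulE normrM (gtr0_norm su) ltr_pM2r// (lt_le_trans _ (ler_norm _))//.
  by rewrite -ru mulratio_cos_lt//; [exact: leq_trans hn|exact: ltW|exact: ltW].
have a : `|sin `|u| | = `|sin u| /\ `|sin (n%:R * `|u|)| = `|sin (n%:R * u)|.
  case: (leP 0 u) => u3; first by rewrite (ger0_norm u3).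
  by rewrite (ltr0_norm u3) mulrN !sinN !normrN.
have upi' : `|u| <= pi by rewrite ler_norml.
have [h1|h1] := leP (u0 n N) `|u|.
  have h2 : pi - u0 n N < `|u| by rewrite ltNge; apply/negP => h2; apply: nr; rewrite h1.
  move: upi'; rewrite le_eqVlt => /predU1P[e|h3].
    left; apply/eqP; rewrite -normr_eq0 -a.1 e sinpi normr0//.
  right; rewrite -a.1 -a.2 -(sin_mul_reflect `|u|) -(sin_reflect `|u|); apply: H; lra.
have [->|unz] := eqVneq u 0; first by left; rewrite sin0.
right; rewrite -a.1 -a.2; apply: H; rewrite h1 andbT normr_gt0//.
Qed.

End Lobes.

(** * Roots of the transcendental equation *)

Section Roots.
Variables (R : realType) (n : nat) (N : R).
Hypotheses (hn : (3 <= n)%N) (hN : Nmin R n < N).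
Implicit Types (u v : R).

Let N_gt1 : 1 < N. Proof. exact: le_lt_trans (Nmin_ge1 _ hn) hN. Qed.
Let n1 : (1 < n)%N. Proof. exact: leq_trans hn. Qed.

(** The right side of the transcendental equation. *)
Let rhs u := N ^+ 2 * sin u ^+ 2 - sin (n%:R * u) ^+ 2.

Lemma rhs_ge0 u : (0 <= rhs u) = (`|sin (n%:R * u)| <= N * `|sin u|).
Proof.
have N0 : 0 <= N by apply: ltW (lt_trans ltr01 N_gt1).
rewrite subr_ge0 -exprMn -real_normK ?num_real// -[leRHS]real_normK ?num_real//.
by rewrite normrM (ger0_norm N0) ler_pXn2r// ?nnegrE ?mulr_ge0.
Qed.

Lemma rhs_ge0_gt u : n%:R < N -> 0 <= rhs u ?= iff (sin u == 0).
Proof.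
move=> nN; have h := sin_mul_le n u.
have s0 : 0 <= `|sin u| by [].
have N1 := N_gt1.
split; first by rewrite rhs_ge0; nra.
apply/eqP/eqP => [h0|h0]; last by rewrite /rhs sin_mulE h0 mulr0 expr0n/= mulr0 subrr.
apply/eqP; rewrite -normr_eq0; apply: contraTT isT => s1.
have {}s1 : 0 < `|sin u| by rewrite lt_neqAle eq_sym s1.
have : `|sin (n%:R * u)| ^+ 2 < (N * `|sin u|) ^+ 2.
  by rewrite ltrXn2r//=; nra.
by rewrite exprMn !real_normK ?num_real// -subr_gt0 -/(rhs u) -h0 ltxx.
Qed.

Lemma v0_spec : n%:R < N -> 0 < v0 n N /\ mulratio (@cosh R) n (v0 n N) = N.
Proof.
move=> nN; have [v] : [set v : R | 0 <= v /\ sinh_ratio n v = N] !=set0.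
  have [v v0 e] := mulratio_cosh_surj n1 (ltW nN).
  by exists v; split => //; rewrite sinh_ratioE.
move=> /(@getI _ _) []; rewrite -/(v0 n N) sinh_ratioE => h1 h2; split => //.
rewrite lt_neqAle h1 andbT; apply/eqP => e; move: nN.
by rewrite -h2 -e mulratio0 ?cosh0// ltxx.
Qed.

(** The left side is negative on ]0, v_0[, vanishes at v_0 and increases afterwards,
while the right side is nonnegative and vanishes only with sin u. *)
Lemma transc_root_gt u : n%:R < N ->
  exists v, [/\ v0 n N <= v, transc_eq n N u v, v = v0 n N <-> sin u = 0
    & forall v', 0 < v' -> transc_eq n N u v' -> v' = v].
Proof.
move=> nN; have [p0 r0] := v0_spec nN; have N1 := N_gt1.
have N0 : 0 <= N by lra.
have [T0 T1] := rhs_ge0_gt u nN.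
have e0 : excess n N (v0 n N) = 0 by rewrite excessE r0 subrr mulr0.
have [||v hv ev] := @excess_surj R n N (v0 n N) (rhs u) n1 N0 (ltW p0).
- by rewrite r0.
- by rewrite e0.
exists v; split => //.
- split => [e|su]; first by apply/eqP; rewrite -T1 -ev e e0.
  have {}T1 : rhs u = 0 by move: T1; rewrite su eqxx => /eqP.
  apply/eqP; rewrite eq_le hv andbT leNgt; apply/negP => lt.
  by have := excess_lt n1 N0 (ltW p0) lt; rewrite r0 e0 ev T1 ltxx => /(_ (lexx _)).
move=> v' v'0 ev'; have {}ev' : excess n N v' = rhs u := ev'.
have hv' : v0 n N <= v'.
  rewrite leNgt; apply/negP => lt.
  have rlt := mulratio_cosh_lt n1 (ltW v'0) lt; rewrite r0 in rlt.
  have : excess n N v' < 0.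
    rewrite excessE pmulr_rlt0 ?exprn_gt0 ?sinh_gt0//.
    by rewrite subr_lt0 ltrXn2r ?mulratio_cosh_ge0.
  by rewrite ev' ltNge T0.
have rr w : v0 n N <= w -> N <= mulratio (@cosh R) n w.
  rewrite le_eqVlt => /predU1P[<-|lt]; first by rewrite r0.
  by rewrite -[leLHS]r0; apply/ltW/mulratio_cosh_lt => //; exact: ltW.
case: (ltgtP v v') => // lt; exfalso.
- have := excess_lt n1 N0 (le_trans (ltW p0) hv) lt (rr _ hv).
  by rewrite ev ev' ltxx.
- have := excess_lt n1 N0 (ltW v'0) lt (rr _ hv').
  by rewrite ev ev' ltxx.
Qed.

Lemma transc_root_le u : N <= n%:R -> urange n N u ->
  exists v, [/\ 0 <= v, transc_eq n N u v
    & forall v', 0 <= v' -> transc_eq n N u v' -> v' = v].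
Proof.
move=> nN hu; have N1 := N_gt1; have N0 : 0 <= N by lra.
have T0 : 0 <= rhs u by rewrite rhs_ge0; apply: sin_mul_le_urange.
have rr w : 0 <= w -> N <= mulratio (@cosh R) n w.
  rewrite le_eqVlt => /predU1P[<-|lt]; first by rewrite mulratio0 ?cosh0.
  apply: le_trans nN _; rewrite -(@mulratio0 _ (@cosh R) n) ?cosh0//.
  exact: mulratio_cosh_le.
have [||v hv ev] := @excess_surj R n N 0 (rhs u) n1 N0 (lexx 0).
- exact: rr.
- by rewrite excessE sinh0 expr0n mul0r.
exists v; split => // v' hv' ev'; have {}ev' : excess n N v' = rhs u := ev'.
case: (ltgtP v v') => // lt; exfalso.
- by have := excess_lt n1 N0 hv lt (rr _ hv); rewrite ev ev' ltxx.
- by have := excess_lt n1 N0 hv' lt (rr _ hv'); rewrite ev ev' ltxx.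
Qed.

Lemma vsol_gt u : n%:R < N ->
  [/\ 0 < vsol n N u, v0 n N <= vsol n N u, transc_eq n N u (vsol n N u),
    vsol n N u = v0 n N <-> sin u = 0
  & forall v, 0 < v -> transc_eq n N u v -> v = vsol n N u].
Proof.
move=> nN; have [v [h1 h2 h3 h4]] := transc_root_gt u nN.
have [p0 _] := v0_spec nN.
rewrite /vsol nN.
have [g1 g2] : [set v : R | 0 < v /\ transc_eq n N u v]
    (get [set v : R | 0 < v /\ transc_eq n N u v]).
  by apply: (@getI _ _ v); split => //; exact: lt_le_trans h1.
by rewrite (h4 _ g1 g2); split => //; exact: lt_le_trans h1.
Qed.

Lemma vsol_le u : N <= n%:R -> urange n N u ->
  [/\ 0 <= vsol n N u, transc_eq n N u (vsol n N u)
  & forall v, 0 <= v -> transc_eq n N u v -> v = vsol n N u].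
Proof.
move=> nN hu; have [v [h1 h2 h3]] := transc_root_le nN hu.
rewrite /vsol ltNge nN /=.
have [g1 g2] : [set v : R | 0 <= v /\ transc_eq n N u v]
    (get [set v : R | 0 <= v /\ transc_eq n N u v]) by apply: (@getI _ _ v).
by rewrite (h3 _ g1 g2).
Qed.

Lemma sin_eq0_pi u : - pi <= u <= pi -> (sin u = 0 <-> u = 0 \/ `|u| = pi).
Proof.
move=> hu; split; last first.
  case=> [->|h]; first exact: sin0.
  apply/eqP; move/eqP: h; rewrite eqr_norml pi_ge0 andbT => /orP[] /eqP ->.
    by rewrite sinpi.
  by rewrite sinN sinpi oppr0.
move=> su; have [->|u0] := eqVneq u 0; [by left|right].
apply/eqP; rewrite eq_le ler_norml hu/= leNgt; apply/negP => lt.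
have : sin `|u| = 0.
  by case: (ler0P u) => _; rewrite ?sinN su ?oppr0.
by move/eqP; rewrite gt_eqF// sin_gt0_pi// normr_gt0 u0.
Qed.

(** The roots with v >= 0 all lie on the curve u |-> (u, v(n, N, u)) over R(n, N).
The last hypothesis concerns the point v = 0, sin u = 0, which solves the equation
for every N but belongs to the curve only when N = n. *)
Lemma vsol_complete u v : - pi <= u <= pi -> 0 <= v -> transc_eq n N u v ->
    (sin u = 0 -> v = 0 -> N = n%:R) ->
  urange n N u /\ v = vsol n N u.
Proof.
move=> hu hv ev h0; have N1 := N_gt1.
have T v' : 0 <= v' -> N <= n%:R -> 0 <= excess n N v' ?= iff (v' == 0).
  move=> v'0 nN; have N0 : 0 <= N by lra.
  have e0 : excess n N 0 = 0 by rewrite excessE sinh0 expr0n mul0r.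
  move: v'0; rewrite le_eqVlt => /predU1P[<-|lt]; first by rewrite e0 eqxx; apply/leif_refl.
  have := excess_lt n1 N0 (lexx 0) lt.
  rewrite mulratio0 ?cosh0// nN e0 => /(_ isT) l.
  by split; [exact: ltW | rewrite lt_eqF// gt_eqF].
have [nN|nN] := ltP n%:R N.
  have [g1 g2 g3 g4 g5] := vsol_gt u nN.
  split; first by rewrite /urange/= nN.
  apply: g5 => //; rewrite lt_neqAle hv andbT; apply/eqP => e; rewrite -e in ev.
  have su : sin u = 0.
    have [_ /esym/eqP] := rhs_ge0_gt u nN; rewrite /rhs -ev.
    rewrite sinh0 mulr0 sinh0 expr0n/= mulr0 subrr eqxx.
    exact.
  by move: nN; rewrite -(h0 su (esym e)) ltxx.
have hr : urange n N u.
  apply: contrapT => nr; have [nN' [su|lt]] := notin_urange hn hN nN hu nr.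
    have [_] := T v hv nN.
    have -> : excess n N v = 0.
      by rewrite /excess ev sin_mulE su mulr0 expr0n/= mulr0 subrr.
    rewrite eqxx => /esym/eqP v0; move: nN'; rewrite (h0 su v0) ltxx//.
  have [+ _] := T v hv nN; rewrite /excess ev -/(rhs u) rhs_ge0 leNgt.
  by rewrite lt.
by split => //; have [_ _] := vsol_le nN hr; apply.
Qed.

End Roots.

(** * Eigenvectors of Kac-Murdock-Szego matrices as standing waves *)

Section Modes.
Variable R : realType.
Implicit Types (rho lambda c eps : R[i]) (n : nat).

Section PartialSums.
Variables (rho : R[i]) (f : nat -> R[i]).

(** A row of K_n(rho), cut at its diagonal, is rho times the sum on the left plus
the sum on the right; with this power of rho split off, both sums obey a first
order recurrence in j. *)
Definition lsum j := \sum_(k < j) rho ^+ (j.-1 - k) * f k.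
Definition rsum m j := \sum_(k < m) rho ^+ k * f (j + k)%N.

Lemma lsum0 : lsum 0 = 0.
Proof. by rewrite /lsum big_ord0. Qed.

Lemma lsumS j : lsum j.+1 = rho * lsum j + f j.
Proof.
rewrite /lsum big_ord_recr /= subnn expr0 mul1r big_distrr /=; congr (_ + _).
apply: eq_bigr => -[k kj] _ /=; rewrite mulrA -exprS; congr (_ ^+ _ * _).
by case: j kj => // j kj; rewrite subSn.
Qed.

Lemma rsum0 j : rsum 0 j = 0.
Proof. by rewrite /rsum big_ord0. Qed.

Lemma rsumS m j : rsum m.+1 j = f j + rho * rsum m j.+1.
Proof.
rewrite /rsum big_ord_recl /= expr0 mul1r addn0 big_distrr /=; congr (_ + _).
by apply: eq_bigr => k _; rewrite /bump /= add1n exprS mulrA addSnnS.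
Qed.

Lemma row_sumE n j : (j <= n)%N ->
  \sum_(k < n) rho ^+ `|j%:Z - k%:Z|%N * f k = rho * lsum j + rsum (n - j) j.
Proof.
move=> jn.
rewrite -(big_mkord xpredT (fun k => rho ^+ `|j%:Z - k%:Z|%N * f k)).
rewrite (big_cat_nat (leq0n j) jn)//=; congr (_ + _).
  rewrite big_mkord /lsum big_distrr /=; apply: eq_bigr => -[k kj] _ /=.
  rewrite mulrA -exprS distnEl; last exact: ltnW.
  by case: j kj {jn} => // j kj; rewrite subSn.
rewrite -{1}(add0n j) big_addn big_mkord; apply: eq_bigr => k _.
by rewrite distnEr ?leq_addl// addnK addnC.
Qed.

End PartialSums.

(** The entries of the vector are p 1, ..., p n; the values p 0 and p (n + 1) carry
the boundary conditions. *)
Definition wave c n (p : nat -> R[i]) :=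
  forall j, (j < n)%N -> p j.+2 + p j = 2 * c * p j.+1.

Definition parity eps n (p : nat -> R[i]) :=
  forall j, (j <= n.+1)%N -> p (n.+1 - j)%N = eps * p j.

(** (1 - rho e^(i mu)) (1 - rho e^(-i mu)) with c = cos mu. *)
Definition poisson_den rho c := 1 - 2 * rho * c + rho ^+ 2.

(** Both partial sums of the row telescope: times the denominator, the left one is
p j - rho p (j + 1) and the right one is p (j + 1) - rho p j. *)
Lemma KMS_wave rho c n p j : wave c n p -> p 0%N = rho * p 1%N ->
    p n.+1 = rho * p n -> (j < n)%N ->
  poisson_den rho c * \sum_(k < n) rho ^+ `|j%:Z - k%:Z|%N * p k.+1 =
  (1 - rho ^+ 2) * p j.+1.
Proof.
move=> hp p0 pn jn; rewrite (row_sumE rho (fun k => p k.+1)) 1?ltnW//.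
have hl i : (i <= n)%N -> poisson_den rho c * lsum rho (fun k => p k.+1) i = p i - rho * p i.+1.
  elim: i => [|i IH] hi; first by rewrite lsum0 p0 mulr0 subrr.
  rewrite lsumS mulrDr mulrCA IH 1?ltnW//.
  have -> : p i.+2 = 2 * c * p i.+1 - p i by rewrite -(hp i hi) addrK.
  by rewrite /poisson_den; ring.
have hr m i : (i + m = n)%N ->
    poisson_den rho c * rsum rho (fun k => p k.+1) m i = p i.+1 - rho * p i.
  elim: m i => [|m IH] i hi.
    by rewrite rsum0 mulr0; move: hi; rewrite addn0 => ->; rewrite pn subrr.
  rewrite rsumS mulrDr mulrCA IH ?addSnnS//.
  have -> : p i.+2 = 2 * c * p i.+1 - p i.
    by rewrite -(hp i) ?addrK// -hi -[ltnLHS]addn0 ltn_add2l.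
  by rewrite /poisson_den; ring.
by rewrite mulrDr mulrCA hl 1?ltnW// hr ?subnKC 1?ltnW//; ring.
Qed.

Lemma KMS_row rho n (x : 'cV[R[i]]_n) (j : 'I_n) :
  (KMS n rho *m x) j 0 = \sum_(k < n) rho ^+ `|j%:Z - k%:Z|%N * x k 0.
Proof. by rewrite mxE; apply: eq_bigr => k _; rewrite mxE. Qed.

(** If rho^2 = 1, K_n(rho) has rank one and the geometric vector is its
eigenvector for n. *)
Lemma geometric_row rho n (f : nat -> R[i]) j : rho ^+ 2 = 1 -> (j < n)%N ->
    (forall k, (k.+1 < n)%N -> f k.+1 = rho * f k) ->
  \sum_(k < n) rho ^+ `|j%:Z - k%:Z|%N * f k = n%:R * f j.
Proof.
move=> r2 jn hf.
have fE k : (k < n)%N -> f k = rho ^+ k * f 0%N.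
  elim: k => [|k IH] hk; first by rewrite mul1r.
  by rewrite hf// IH 1?ltnW// exprS mulrA.
have rE k : rho ^+ `|j%:Z - k%:Z|%N * rho ^+ k = rho ^+ j.
  have [h|h] := leqP k j; first by rewrite distnEl// -exprD subnK.
  rewrite distnEr 1?ltnW// -exprD -{2}(subnK (ltnW h)) addnA addnn -mul2n exprD.
  by rewrite exprM r2 expr1n mul1r.
transitivity (\sum_(k < n) f j); last by rewrite sumr_const card_ord mulr_natl.
by apply: eq_bigr => k _; rewrite fE// mulrA rE -fE.
Qed.

(** A vanishing denominator forces rho = c = 1 or -1; the wave is then geometric. *)
Lemma mode_eigenvector rho lambda c eps n p : (0 < n)%N -> eps ^+ 2 = 1 ->
    wave c n p -> parity eps n p -> p n.+1 = rho * p n -> p n != 0 ->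
    lambda * poisson_den rho c = 1 - rho ^+ 2 -> (poisson_den rho c = 0 -> lambda = n%:R) ->
  exists x : 'cV[R[i]]_n, [/\ x != 0, forall j, x (rev_ord j) 0 = eps * x j 0
    & KMS n rho *m x = lambda *: x].
Proof.
move=> n0 e2 hp hs pn pn0 hl h1.
have p1 : p 1%N = eps * p n by rewrite -hs// subSn// subnn.
have p0 : p 0%N = rho * p 1%N.
  have -> : p 0%N = eps * p n.+1 by rewrite -hs// subnn.
  by rewrite pn p1; ring.
exists (\col_(k < n) p k.+1); split.
- have ln : (n.-1 < n)%N by rewrite ltn_predL.
  apply/eqP => /colP/(_ (Ordinal ln)); rewrite !mxE /= prednK// => h.
  by rewrite h eqxx in pn0.
- move=> j; rewrite !mxE /= -hs; last by rewrite ltnS ltnW.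
  by rewrite subSS -subSn.
apply/colP => j; rewrite KMS_row [RHS]mxE mxE.
have -> : \sum_(k < n) rho ^+ `|j%:Z - k%:Z|%N * (\col_(k0 < n) p k0.+1) k 0 =
          \sum_(k < n) rho ^+ `|j%:Z - k%:Z|%N * p k.+1.
  by apply: eq_bigr => k _; rewrite mxE.
have [D0|D0] := eqVneq (poisson_den rho c) 0; last first.
  apply: (mulfI D0); rewrite KMS_wave// mulrA; congr (_ * _).
  by rewrite -hl mulrC.
have r2 : rho ^+ 2 = 1.
  by move/eqP: hl; rewrite D0 mulr0 eq_sym subr_eq0 => /eqP.
have r0 : rho != 0 by apply/eqP => r0; move/eqP: r2; rewrite r0 expr0n eq_sym oner_eq0.
have cE : c = rho.
  move/eqP: (D0); rewrite /poisson_den r2 addrAC subr_eq0 => /eqP h.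
  apply: (mulfI r0); rewrite -expr2 r2.
  by apply: (mulfI (_ : 2 != 0 :> R[i])); rewrite ?pnatr_eq0// mulrA -h; ring.
rewrite h1// (geometric_row (f := fun k => p k.+1) r2)//.
move=> k kn; have {}kn := ltnW kn.
elim: k kn => [|k IH] kn.
  have := hp 0%N kn; rewrite p0 cE => /eqP; rewrite eq_sym -subr_eq => /eqP <-; ring.
have := hp k.+1 kn; rewrite (IH (ltnW kn)) cE => h.
have -> : p k.+3 = 2 * rho * (rho * p k.+1) - p k.+1 by rewrite -h addrK.
transitivity (rho ^+ 2 * p k.+1 * 2 - p k.+1); first by ring.
rewrite r2; transitivity (rho ^+ 2 * p k.+1); last by ring.
by rewrite r2; ring.
Qed.

(** The value of c is forced by lambda (1 - 2 rho c + rho^2) = 1 - rho^2.  The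
recurrence follows from lambda (p j - rho p (j + 1)) = (1 - rho^2) l_j, where l_j is
the left partial sum, because l satisfies a first order recurrence. *)
Lemma eigenvector_mode rho lambda eps n (x : 'cV[R[i]]_n) : (0 < n)%N -> eps ^+ 2 = 1 ->
    rho != 0 -> lambda != 0 ->
    x != 0 -> (forall j, x (rev_ord j) 0 = eps * x j 0) ->
    KMS n rho *m x = lambda *: x ->
  exists c p, [/\ wave c n p, parity eps n p, p n.+1 = rho * p n & p n != 0] /\
    lambda * poisson_den rho c = 1 - rho ^+ 2 /\ (poisson_den rho c = 0 -> lambda = n%:R).
Proof.
case: n x => // n x _ e2 r0 l0 x0 xs xK.
pose f k := x (inord k) 0.
pose p j := if j == 0%N then rho * f 0%N else if j == n.+2 then rho * f n else f j.-1.
have pS j : (j <= n)%N -> p j.+1 = f j.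
  by move=> jn; rewrite /p /= eqSS ltn_eqF// ltnS.
have p0 : p 0%N = rho * f 0%N by [].
have pn2 : p n.+2 = rho * f n by rewrite /p /= eqxx.
pose l := lsum rho f; pose r j := rsum rho f (n.+1 - j) j.
have y j : (j <= n)%N -> lambda * f j = rho * l j + r j.
  move=> jn; rewrite /l /r -row_sumE; last exact: leqW.
  have := congr1 (fun z : 'cV_n.+1 => z (inord j) 0) xK.
  rewrite KMS_row [RHS]mxE inordK ?ltnS// => <-.
  by apply: eq_bigr => k _; rewrite /f inord_val.
have rS j : (j <= n)%N -> r j = f j + rho * r j.+1.
  by move=> jn; rewrite /r subSn// rsumS subSS.
have key j : (j <= n.+1)%N -> lambda * (p j - rho * p j.+1) = (1 - rho ^+ 2) * l j.
  case: j => [_|j jn]; first by rewrite /l lsum0 p0 pS// subrr !mulr0.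
  have lS : l j.+1 = rho * l j + f j by rewrite /l lsumS.
  have yj := y j jn.
  rewrite pS// mulrBr (mulrCA lambda) yj rS// lS.
  move: jn; rewrite ltnS leq_eqVlt => /predU1P[jn|jn].
    have -> : p j.+2 = rho * f j by rewrite jn pn2.
    transitivity (rho * l j + (f j + rho * r j.+1) - rho ^+ 2 * (lambda * f j)); first by ring.
    have r0' : r j.+1 = 0 by rewrite /r jn subnn rsum0.
    have jn' : (j <= n)%N by rewrite jn.
    rewrite yj (rS j jn').
    by rewrite r0'; ring.
  by rewrite pS// y// lS; ring.
pose c := (lambda * (1 + rho ^+ 2) - (1 - rho ^+ 2)) / (2 * lambda * rho).
have cE : 2 * c * (lambda * rho) = lambda * (1 + rho ^+ 2) - (1 - rho ^+ 2).
  by rewrite /c; field; rewrite ?l0 ?r0.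
have hp : wave c n.+1 p.
  move=> j jn; have k0 := key j (ltnW jn); have k1 := key j.+1 jn.
  have lS : l j.+1 = rho * l j + p j.+1 by rewrite /l lsumS pS.
  apply: (mulfI (mulf_neq0 l0 r0)).
  have -> : lambda * rho * (2 * c * p j.+1) = (2 * c * (lambda * rho)) * p j.+1 by ring.
  rewrite cE.
  transitivity (lambda * (1 + rho ^+ 2) * p j.+1 - (lambda * (p j.+1 - rho * p j.+2)
     - rho * (lambda * (p j - rho * p j.+1)))); first by ring.
  by rewrite k0 k1 lS; ring.
have ps : parity eps n.+1 p.
  have fs j : (j <= n)%N -> f (n - j)%N = eps * f j.
    move=> jn; rewrite /f -xs; congr (x _ _); apply/val_inj => /=.
    by rewrite !inordK ?ltnS ?leq_subr// subSS.
  case=> [|j] jn.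
    rewrite subn0 pn2 p0 mulrCA; congr (_ * _).
    by rewrite -{1}(subn0 n) fs.
  rewrite subSS; move: jn; rewrite ltnS leq_eqVlt => /predU1P[->|jn].
    by rewrite subnn p0 pn2 mulrCA -fs// subnn.
  by rewrite subSn// !pS ?leq_subr// fs.
have pnn : p n.+2 = rho * p n.+1 by rewrite pn2 pS.
have pn0 : p n.+1 != 0.
  apply: contra x0 => /eqP pn0.
  have pz m : (m <= n.+1)%N -> p (n.+1 - m)%N = 0 /\ p (n.+2 - m)%N = 0.
    elim: m => [|m IH] hm; first by rewrite !subn0 pnn pn0 mulr0.
    have [h1 h2] := IH (ltnW hm).
    split; last by rewrite subSS.
    have mn : (m <= n)%N by [].
    have := hp (n - m)%N; rewrite ltnS leq_subr => /(_ isT).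
    by rewrite -!subSn ?leqW// h1 h2 mulr0 add0r subSS.
  apply/eqP/colP => k; rewrite [RHS]mxE.
  have kn : (k <= n)%N by rewrite -ltnS ltn_ord.
  have -> : x k 0 = p k.+1 by rewrite pS// /f inord_val.
  by have [_] := pz (n.+1 - k)%N (leq_subr _ _); rewrite subSn ?leq_subr// subKn// leqW.
have denE : lambda * poisson_den rho c = 1 - rho ^+ 2.
  rewrite /poisson_den; transitivity (lambda * (1 + rho ^+ 2) - 2 * c * (lambda * rho)); first by ring.
  by rewrite cE; ring.
exists c, p; split; [by []|split].
  exact: denE.
move=> D0; have r2 : rho ^+ 2 = 1.
  by move/eqP: denE; rewrite D0 mulr0 eq_sym subr_eq0 => /eqP.
have fS k : (k.+1 < n.+1)%N -> f k.+1 = rho * f k.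
  move=> kn; have := key k.+1 (ltnW kn).
  rewrite r2 subrr mul0r => /eqP; rewrite mulf_eq0 (negPf l0) /= subr_eq0 => /eqP.
  rewrite (pS k (ltnW kn)) (pS k.+1 kn) => ->.
  by rewrite mulrA -expr2 r2 mul1r.
apply: (mulIf pn0); rewrite pS//.
have := congr1 (fun z : 'cV_n.+1 => z (inord n) 0) xK.
rewrite KMS_row [RHS]mxE inordK ?ltnS// => <-.
rewrite -(geometric_row (f := f) r2)//.
by apply: eq_bigr => k _; rewrite /f inord_val.
Qed.

(** The Casoratian p (j + 1) q j - p j q (j + 1) of two waves does not depend on j,
and the reflection j -> n + 1 - j changes its sign if p and q have the same parity. *)
Lemma casoratian c eps n p q : eps ^+ 2 = 1 -> wave c n p -> wave c n q ->
  parity eps n p -> parity eps n q -> p n.+1 * q n = p n * q n.+1.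
Proof.
move=> e2 hp hq sp sq.
pose w j := p j.+1 * q j - p j * q j.+1.
have wE j : (j <= n)%N -> w j = w 0%N.
  elim: j => // j IH hj; rewrite -(IH (ltnW hj)) /w.
  have -> : p j.+2 = 2 * c * p j.+1 - p j by rewrite -(hp j hj) addrK.
  have -> : q j.+2 = 2 * c * q j.+1 - q j by rewrite -(hq j hj) addrK.
  ring.
have e0 (s : nat -> R[i]) : parity eps n s -> s 0%N = eps * s n.+1.
  by move=> hs; rewrite -hs// subnn.
have e1 (s : nat -> R[i]) : parity eps n s -> s 1%N = eps * s n.
  by move=> hs; rewrite -hs// subSn// subnn.
have := wE n (leqnn n); rewrite /w (e0 p)// (e0 q)// (e1 p)// (e1 q)//.
have -> : eps * p n * (eps * q n.+1) - eps * p n.+1 * (eps * q n) =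
  - (eps ^+ 2 * (p n.+1 * q n - p n * q n.+1)) by ring.
rewrite e2 mul1r => /eqP; rewrite -addr_eq0 -mulr2n mulrn_eq0 /= subr_eq0 => /eqP.
exact.
Qed.

End Modes.

(** * Complex sine and cosine *)

Section ComplexTrig.
Variable R : realType.
Implicit Types (z w h : R[i]) (x y u v N : R) (k : nat).

Lemma cexpD z w : cexp (z + w) = cexp z * cexp w.
Proof.
case: z w => [a b] [c d]; rewrite /cexp /= expRD cosD sinD.
by apply/eqP; rewrite eq_complex /=; apply/andP; split; apply/eqP; ring.
Qed.

Lemma cexp0 : cexp 0 = 1 :> R[i].
Proof.
by rewrite /cexp /= expR0 cos0 sin0; apply/eqP; rewrite eq_complex /=;
  apply/andP; split; apply/eqP; ring.
Qed.

Lemma complex_i_neq0 : 'i%C != 0 :> R[i].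
Proof. by rewrite eq_complex /= oner_eq0 andbF. Qed.

Lemma csinD z w : csin (z + w) = csin z * ccos w + ccos z * csin w.
Proof.
rewrite /csin /ccos mulrDr opprD !cexpD; field; exact: complex_i_neq0.
Qed.

Lemma ccosD z w : ccos (z + w) = ccos z * ccos w - csin z * csin w.
Proof.
rewrite /csin /ccos mulrDr opprD !cexpD.
have e : 'i%C * 'i%C = -1 :> R[i] by rewrite -expr2 sqr_i.
have key (a b c d : R[i]) : (a - b) / (2 * 'i) * ((c - d) / (2 * 'i)) =
    - ((a - b) * (c - d) / 4).
  transitivity ((a - b) * (c - d) / (4 * ('i * 'i))); last by rewrite e; field.
  by field; exact: complex_i_neq0.
by rewrite key; field.
Qed.

Lemma csin0 : csin 0 = 0 :> R[i].
Proof. by rewrite /csin mulr0 oppr0 subrr mul0r. Qed.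

Lemma ccos0 : ccos 0 = 1 :> R[i].
Proof. by rewrite /ccos mulr0 oppr0 cexp0; field. Qed.

Lemma csinN z : csin (- z) = - csin z.
Proof. by rewrite /csin mulrN opprK; field; exact: complex_i_neq0. Qed.

Lemma ccosN z : ccos (- z) = ccos z.
Proof. by rewrite /ccos mulrN opprK addrC. Qed.

Lemma ccosB z w : ccos (z - w) = ccos z * ccos w + csin z * csin w.
Proof. by rewrite ccosD ccosN csinN mulrN opprK. Qed.

Lemma ccos2Dcsin2 z : ccos z ^+ 2 + csin z ^+ 2 = 1.
Proof. by rewrite -ccos0 -(subrr z) ccosB !expr2. Qed.

Lemma csin_mulE k z : csin (k%:R * z) = mulratio (@ccos R) k z * csin z.
Proof. exact: (mulratioE k z csin0 csinD). Qed.

Lemma csinE u v : csin (u +i* v) = (sin u * cosh v) +i* (cos u * sinh v).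
Proof.
rewrite /csin /cexp /cosh /sinh /= !(mul0r, mul1r, sub0r, addr0, add0r, opprK).
apply/(mulIf (_ : 2 * 'i%C != 0)).
  by rewrite mulf_neq0 ?complex_i_neq0 ?pnatr_eq0.
rewrite divfK ?mulf_neq0 ?complex_i_neq0 ?pnatr_eq0//.
apply/eqP; rewrite eq_complex /= cosN sinN; apply/andP; split; apply/eqP; by field.
Qed.

Lemma ccosE u v : ccos (u +i* v) = (cos u * cosh v) +i* (- (sin u * sinh v)).
Proof.
rewrite /ccos /cexp /cosh /sinh /= !(mul0r, mul1r, sub0r, addr0, add0r, opprK).
apply/(mulIf (_ : 2 != 0)); first by rewrite pnatr_eq0.
rewrite divfK ?pnatr_eq0//.
apply/eqP; rewrite eq_complex /= cosN sinN; apply/andP; split; apply/eqP; by field.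
Qed.

Lemma natc_mul k u v : k%:R * (u +i* v) = (k%:R * u) +i* (k%:R * v) :> R[i].
Proof.
have -> : k%:R = k%:R%:C :> R[i] by rewrite rmorph_nat.
by apply/eqP; rewrite eq_complex /= !mul0r subr0 addr0 !eqxx.
Qed.

Lemma normc_sqr u v : `|u +i* v| ^+ 2 = (u ^+ 2 + v ^+ 2)%:C.
Proof. by rewrite -add_Re2_Im2. Qed.

Lemma norm_csin_sqr u v : `|csin (u +i* v)| ^+ 2 = (sin u ^+ 2 + sinh v ^+ 2)%:C.
Proof.
rewrite csinE normc_sqr; congr (_ %:C).
have e : cosh v ^+ 2 = 1 + sinh v ^+ 2 :> R by rewrite -(cosh2Bsinh2 v); ring.
transitivity (sin u ^+ 2 * cosh v ^+ 2 + cos u ^+ 2 * sinh v ^+ 2); first by ring.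
rewrite e cos2sin2; ring.
Qed.

Lemma csin_eq0 u v : csin (u +i* v) = 0 <-> sin u = 0 /\ v = 0.
Proof.
split=> [h|[h ->]]; last by rewrite csinE h sinh0 mul0r mulr0.
have : `|csin (u +i* v)| ^+ 2 = 0 by rewrite h normr0 expr0n.
rewrite norm_csin_sqr => /complexI/eqP.
rewrite paddr_eq0 ?sqr_ge0// !sqrf_eq0 => /andP[/eqP h1].
by rewrite sinh_eq0 => /eqP.
Qed.

(** By [norm_csin_sqr]; away from the zeros of sin mu this is |b(mu)| = N. *)
Lemma transc_norm n N u v : 0 <= N ->
  transc_eq n N u v <-> `|csin (n%:R * (u +i* v))| = N%:C * `|csin (u +i* v)|.
Proof.
move=> N0.
have b0 : 0 <= N%:C * `|csin (u +i* v)|.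
  by apply: mulr_ge0; [rewrite ler0c | exact: normr_ge0].
rewrite [X in _ <-> X](rwP eqP) -(eqrXn2 (isT : (0 < 2)%N) (normr_ge0 _) b0) -(rwP eqP).
rewrite exprMn natc_mul !norm_csin_sqr -rmorphXn -rmorphM.
rewrite /transc_eq; split => [h|/complexI h]; last by lra.
by congr (_%:C); lra.
Qed.

Lemma normc_i : `|'i%C| = 1 :> R[i].
Proof. by rewrite normc_def /= expr0n expr1n add0r sqrtr1. Qed.

Lemma normc_real x : `|x%:C| = `|x|%:C :> R[i].
Proof. by rewrite normc_def /= expr0n addr0 sqrtr_sqr. Qed.

Lemma normc_ge_Im z : `|complex.Im z|%:C <= `|z|.
Proof.
have := normc_ge_Re (z * 'i%C); rewrite ReiNIm normrN normrM.
by rewrite normc_i mulr1.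
Qed.

Lemma Re_continuous : continuous (@complex.Re R : R[i]^o -> R).
Proof.
move=> z; apply: (proj2 (@cvgrPdist_lt R R R[i]^o (nbhs z) _ _ _)) => e e0.
near=> w.
rewrite -ltcR -raddfB; apply: le_lt_trans (normc_ge_Re (z - w)) _.
near: w; have := @cvgr_dist_lt R[i] R[i]^o _ (nbhs z) _ id z cvg_id e%:C.
by rewrite ltcR; exact.
Unshelve. all: by end_near.
Qed.

Lemma Im_continuous : continuous (@complex.Im R : R[i]^o -> R).
Proof.
move=> z; apply: (proj2 (@cvgrPdist_lt R R R[i]^o (nbhs z) _ _ _)) => e e0.
near=> w.
rewrite -ltcR -raddfB; apply: le_lt_trans (normc_ge_Im (z - w)) _.
near: w; have := @cvgr_dist_lt R[i] R[i]^o _ (nbhs z) _ id z cvg_id e%:C.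
by rewrite ltcR; exact.
Unshelve. all: by end_near.
Qed.

Lemma norm_Complex_le x y : `|x +i* y| <= (`|x| + `|y|)%:C.
Proof.
have -> : x +i* y = x%:C + 'i%C * y%:C by rewrite [LHS]complexE.
apply: le_trans (ler_normD _ _) _; rewrite normrM.
by rewrite normc_i mul1r !normc_real rmorphD.
Qed.

Lemma cvg_Complex (T : Type) (F : set_system T) (f g : T -> R) x y :
  Filter F -> f t @[t --> F] --> x -> g t @[t --> F] --> y ->
  ((f t +i* g t) : R[i]^o) @[t --> F] --> ((x +i* y) : R[i]^o).
Proof.
move=> FF hf hg; apply/cvgrPdist_lt => -[e e'] /=.
rewrite ltcE /= => /andP[/eqP -> e0].
near=> t.
have -> : (x +i* y) - (f t +i* g t) = (x - f t) +i* (y - g t) by [].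
apply: le_lt_trans (norm_Complex_le _ _) _; rewrite ltcR.
rewrite (splitr e); apply: ltrD.
  by near: t; apply: (cvgr_dist_lt f x hf); rewrite divr_gt0.
by near: t; apply: (cvgr_dist_lt g y hg); rewrite divr_gt0.
Unshelve. all: by end_near.
Qed.

Lemma ccos_continuous : continuous (@ccos R : R[i]^o -> R[i]^o).
Proof.
have -> : (@ccos R : R[i]^o -> R[i]^o) = fun z : R[i]^o =>
    (cos (complex.Re z) * cosh (complex.Im z)) +i*
    (- (sin (complex.Re z) * sinh (complex.Im z))).
  by apply/funext => -[a b]; rewrite ccosE.
move=> z.
have cr (f : R -> R) : continuous f ->
    {for z, continuous ((f \o @complex.Re R) : R[i]^o -> R)}.
  move=> cf; apply: (@continuous_comp R[i]^o R R); [exact: Re_continuous|exact: cf].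
have ci (f : R -> R) : continuous f ->
    {for z, continuous ((f \o @complex.Im R) : R[i]^o -> R)}.
  move=> cf; apply: (@continuous_comp R[i]^o R R); [exact: Im_continuous|exact: cf].
apply: (@cvg_Complex _ (nbhs z)).
  exact: (@continuousM R R[i]^o _ _ z (cr _ (@continuous_cos R)) (ci _ (@cosh_continuous R))).
apply: (@continuousN R R R[i]^o).
exact: (@continuousM R R[i]^o _ _ z (cr _ (@continuous_sin R)) (ci _ (@sinh_continuous R))).
Qed.

Lemma mulratio_ccos_continuous k : continuous (mulratio (@ccos R) k : R[i]^o -> R[i]^o).
Proof.
exact: (@mulratio_continuous R[i] (@ccos R) k ccos_continuous).
Qed.

Lemma csin_neq0 z : z != 0 -> `|z| < pi%:C -> csin z != 0.
Proof.
case: z => u v z0 zpi; apply/eqP => /csin_eq0[su v0].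
have : `|u| < pi by rewrite -ltcR (le_lt_trans (normc_ge_Re (u +i* v))).
rewrite v0 eq_complex/= eqxx andbT in z0.
move=> hu; have : 0 < sin `|u| by rewrite sin_gt0_pi// normr_gt0 z0.
by case: (ler0P u) => _; rewrite ?sinN su ?oppr0 ltxx.
Qed.

(** The removed singularity of F / G when F and G are sine functions of h = w - z.
Both are multiples of csin (c h), and the cofactors are continuous at h = 0. *)
Lemma lim_quot (F G : R[i]^o -> R[i]^o) (p q : nat) (A B c : R[i]) (z : R[i]^o) :
    c != 0 -> B != 0 -> (0 < q)%N ->
    (forall w, F w = A * csin (p%:R * (c * (w - z)))) ->
    (forall w, G w = B * csin (q%:R * (c * (w - z)))) ->
  quot F G z = (A * p%:R) / (B * q%:R).
Proof.
move=> c0 B0 q0 hF hG.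
have F0 : F z = 0 by rewrite hF subrr mulr0 mulr0 csin0 mulr0.
have G0 : G z = 0 by rewrite hG subrr mulr0 mulr0 csin0 mulr0.
rewrite /quot F0 G0 eqxx /=; have PF : ProperFilter (z^') by exact: Proper_dnbhs_numFieldType.
apply: (@cvg_lim R[i]^o (@norm_hausdorff _ R[i]^o) _ _ PF).
pose g (w : R[i]^o) : R[i]^o := (A * mulratio (@ccos R) p (c * (w - z))) /
  (B * mulratio (@ccos R) q (c * (w - z))).
pose t (w : R[i]^o) : R[i]^o := c * (w - z).
have tz : t z = 0 by rewrite /t subrr mulr0.
have ct : {for z, continuous t}.
  apply: (@continuousM R[i] R[i]^o (cst c) (fun w => w - z)).
    exact: cst_continuous.
  apply: (@continuousB R[i] R[i]^o R[i]^o id (cst z)); first exact: cvg_id.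
  exact: cst_continuous.
have cr k : {for z, continuous (mulratio (@ccos R) k \o t : R[i]^o -> R[i]^o)}.
  exact: (@continuous_comp R[i]^o R[i]^o R[i]^o t _ z ct (@mulratio_ccos_continuous k (t z))).
have cAr D k : {for z, continuous (fun w : R[i]^o => D * mulratio (@ccos R) k (t w) : R[i]^o)}.
  apply: (@continuousM R[i] R[i]^o (cst D) (mulratio (@ccos R) k \o t) z _ (cr k)).
  exact: cst_continuous.
have gz : g z = (A * p%:R) / (B * q%:R).
  by rewrite /g -/(t z) tz !mulratio0// ccos0.
have cg : {for z, continuous g}.
  apply: (@continuousM R[i] R[i]^o _ (fun w => (B * mulratio (@ccos R) q (t w))^-1) z (cAr A p)).
  apply: (@continuousV R[i] R[i]^o _ z _ (cAr B q)).
  by rewrite tz mulratio0 ?ccos0// mulf_neq0// pnatr_eq0 -lt0n.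
rewrite -gz; apply: cvg_trans (proj1 (continuous_withinNx _ _) cg).
apply: near_eq_cvg; near=> w.
have wz : w - z != 0 by rewrite subr_eq0; near: w; exact: nbhs_dnbhs_neq.
have s0 : csin (c * (w - z)) != 0.
  apply: csin_neq0; first by rewrite mulf_neq0.
  near: w; apply: nbhs_dnbhs.
  have := @cvgr_dist_lt R[i] R[i]^o _ (nbhs z) (nbhs_filter z) t (t z) ct pi%:C.
  rewrite ltcR tz => /(_ (pi_gt0 R)).
  by apply: filterS => w /=; rewrite sub0r normrN.
have key (a b m m' s : R[i]) : s != 0 -> a * (m * s) / (b * (m' * s)) = a * m / (b * m').
  by move=> s1; rewrite !mulrA -mulf_div divff// mulr1.
by rewrite hF hG !csin_mulE key.
Unshelve. all: by end_near.
Qed.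

End ComplexTrig.

(** * The two eigenvalue curves *)

Section CcosSurj.
Variable R : realType.
Implicit Types (z c : R[i]).

(** Polar coordinates: mu = u + i v has e^(i mu) = e^(-v) e^(i u), so v >= 0 is the
condition |z| <= 1. *)
Lemma polar z : z != 0 -> `|z| <= 1 ->
  exists u v : R, [/\ - pi <= u <= pi, 0 <= v & cexp ('i%C * (u +i* v)) = z].
Proof.
case: z => x y z0; rewrite normc_def /= -[1]/(1%:C) lecR => m1.
set m := Num.sqrt (x ^+ 2 + y ^+ 2) in m1.
have s0 : 0 < x ^+ 2 + y ^+ 2.
  rewrite lt_neqAle addr_ge0 ?sqr_ge0// andbT eq_sym paddr_eq0 ?sqr_ge0//.
  by rewrite !sqrf_eq0; move: z0; rewrite eq_complex.
have m0 : 0 < m by rewrite sqrtr_gt0.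
have m2 : m ^+ 2 = x ^+ 2 + y ^+ 2 by rewrite sqr_sqrtr// ltW.
have a1 : -1 <= x / m <= 1.
  rewrite -ler_norml normrM normfV (gtr0_norm m0) ler_pdivrMr// mul1r.
  rewrite -(ler_pXn2r (isT : (0 < 2)%N)) ?nnegrE ?(ltW m0)// real_normK ?num_real// m2.
  by rewrite lerDl sqr_ge0.
have cu : cos (acos (x / m)) = x / m by apply: acosK; rewrite in_itv.
have su : sin (acos (x / m)) = `|y| / m.
  rewrite sin_acos// -[RHS]ger0_norm ?divr_ge0 ?(ltW m0)// -sqrtr_sqr; congr Num.sqrt.
  rewrite !exprMn real_normK ?num_real// exprVn m2; field; exact: lt0r_neq0.
pose u := if 0 <= y then acos (x / m) else - acos (x / m).
have [b0 b1] : 0 <= acos (x / m) /\ acos (x / m) <= pi by rewrite acos_ge0 ?acos_lepi.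
exists u, (- ln m); split.
- by rewrite /u; case: ifP => _; have := @pi_ge0 R; lra.
- by rewrite oppr_ge0 ln_le0.
rewrite /= !(mul0r, mul1r, sub0r, add0r, opprK) lnK ?posrE//.
have -> : cos u = x / m by rewrite /u; case: ifP => _; rewrite ?cosN.
have -> : sin u = y / m.
  rewrite /u; case: leP => hy; first by rewrite su ger0_norm.
  by rewrite sinN su ltr0_norm// mulNr opprK.
apply/eqP; rewrite eq_complex /=; apply/andP; split; apply/eqP; field; exact: lt0r_neq0.
Qed.

(** The roots of z + 1/z = 2 c are inverse to each other, so one of them lies in the
closed unit disc; it is e^(i mu). *)
Lemma ccos_surj c :
  exists u v : R, [/\ - pi <= u <= pi, 0 <= v & ccos (u +i* v) = c].
Proof.
have [z [z0 z1 zc]] : exists z, [/\ z != 0, `|z| <= 1 & z + z^-1 = 2 * c].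
  pose s := sqrtc (c ^+ 2 - 1); have s2 : s ^+ 2 = c ^+ 2 - 1 by rewrite sqr_sqrtc.
  have e : (c + s) * (c - s) = 1 by transitivity (c ^+ 2 - s ^+ 2); [ring|rewrite s2; ring].
  have z0 : c + s != 0 by apply/eqP => h; move/eqP: e; rewrite h mul0r eq_sym oner_eq0.
  have zV : (c + s)^-1 = c - s by apply: (mulfI z0); rewrite divff.
  have [h|h] := real_leP (normr_real (c + s)) (real1 _).
    by exists (c + s); split => //; rewrite zV; ring.
  exists (c - s); rewrite -zV invr_eq0 invrK z0; split => //.
    by rewrite normfV invf_le1 ?ltW// normr_gt0.
  by rewrite zV; ring.
have [u [v [hu hv e]]] := polar z0 z1.
exists u, v; split => //; rewrite /ccos e.
have -> : cexp (- ('i%C * (u +i* v))) = z^-1.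
  by apply: (mulfI z0); rewrite divff// -{1}e -cexpD subrr cexp0.
by rewrite zc; field.
Qed.

End CcosSurj.

Section Curves.
Variable R : realType.
(** The skew-symmetric case is (phi, psi, eps) = (sin, cos, -1), the symmetric case is
(cos, sin, 1). *)
Variables (phi psi : R[i] -> R[i]) (eps : R[i]).
Hypothesis eps2 : eps ^+ 2 = 1.
Hypothesis phiD : forall a b, phi (a + b) = phi a * ccos b - eps * psi a * csin b.
Hypothesis psiD : forall a b, psi (a + b) = psi a * ccos b + eps * phi a * csin b.
Hypothesis phiN : forall a, phi (- a) = eps * phi a.
Hypothesis psiN : forall a, psi (- a) = - eps * psi a.
Hypothesis phi2Dpsi2 : forall a, phi a ^+ 2 + psi a ^+ 2 = 1.
Variable n : nat.
Hypothesis hn : (3 <= n)%N.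
Implicit Types (mu a b rho lambda c : R[i]).

Definition curve_rho mu :=
  quot (fun w => phi (n.+1%:R * w / 2)) (fun w => phi (n.-1%:R * w / 2)) mu.
Definition curve_lambda mu := eps * quot (fun w => csin (n%:R * w)) (@csin R) mu.

Let half mu := n.-1%:R * mu / 2.

Let nE : n%:R = n.-1%:R + 1 :> R[i].
Proof. by rewrite natr1 prednK// (leq_trans _ hn). Qed.

Let nSE : n.+1%:R = n.-1%:R + 2 :> R[i].
Proof. by rewrite -natr1 nE; ring. Qed.

Let n1_neq0 : n.-1%:R != 0 :> R[i].
Proof. by rewrite pnatr_eq0; case: n hn => [//|[]]. Qed.

Let halfD mu : n.+1%:R * mu / 2 = half mu + mu.
Proof. by rewrite /half nSE; field. Qed.

Let double mu : n%:R * mu = half mu + half mu + mu.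
Proof. by rewrite /half nE; field. Qed.

Lemma pair_cos2 a : phi a ^+ 2 - psi a ^+ 2 = eps * ccos (a + a).
Proof.
have h1 := phiD (- a) (a + a); have h2 := psiD (- a) (a + a).
rewrite addrA addNr add0r phiN psiN in h1 h2.
transitivity (phi a * phi a - psi a * psi a); first by ring.
rewrite {2}h1 {3}h2.
transitivity (eps * ccos (a + a) * (phi a ^+ 2 + psi a ^+ 2)
   + (eps ^+ 2 - eps ^+ 2) * phi a * psi a * csin (a + a)); first by ring.
by rewrite phi2Dpsi2; ring.
Qed.

Lemma pair_sin2 a : 2 * phi a * psi a = csin (a + a).
Proof.
have h1 := phiD (- a) (a + a); have h2 := psiD (- a) (a + a).
rewrite addrA addNr add0r phiN psiN in h1 h2.
transitivity (psi a * phi a + phi a * psi a); first by ring.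
rewrite {1}h1 {3}h2.
transitivity (eps ^+ 2 * csin (a + a) * (phi a ^+ 2 + psi a ^+ 2)); first by ring.
by rewrite phi2Dpsi2 eps2; ring.
Qed.

(** The numerator 1 - rho^2 of lambda, for rho = phi ((n+1) mu/2) / phi ((n-1) mu/2). *)
Lemma pair_diff_sqr mu :
  phi (half mu) ^+ 2 - phi (half mu + mu) ^+ 2 = eps * csin (n%:R * mu) * csin mu.
Proof.
rewrite double csinD phiD.
set b := half mu.
transitivity ((phi b ^+ 2 * (1 - ccos mu ^+ 2)) + 2 * phi b * psi b * eps * ccos mu * csin mu
  - eps ^+ 2 * psi b ^+ 2 * csin mu ^+ 2); first by ring.
have -> : ccos mu ^+ 2 = 1 - csin mu ^+ 2 by rewrite -(ccos2Dcsin2 mu); ring.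
rewrite eps2 pair_sin2.
transitivity (csin mu * ((phi b ^+ 2 - psi b ^+ 2) * csin mu + eps * csin (b + b) * ccos mu)).
  by ring.
by rewrite pair_cos2; ring.
Qed.

(** The denominator 1 - 2 rho cos mu + rho^2 of lambda, for the same rho. *)
Lemma pair_poisson_den mu :
  phi (half mu) ^+ 2 - 2 * ccos mu * phi (half mu) * phi (half mu + mu)
  + phi (half mu + mu) ^+ 2 = csin mu ^+ 2.
Proof.
rewrite phiD; set b := half mu.
transitivity (phi b ^+ 2 * (1 - ccos mu ^+ 2) + eps ^+ 2 * psi b ^+ 2 * csin mu ^+ 2); first by ring.
have -> : ccos mu ^+ 2 = 1 - csin mu ^+ 2 by rewrite -(ccos2Dcsin2 mu); ring.
transitivity (csin mu ^+ 2 * (phi b ^+ 2 + eps ^+ 2 * psi b ^+ 2)); first by ring.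
by rewrite eps2 mul1r phi2Dpsi2 mulr1.
Qed.

Let node j : R[i] := j%:R - n.+1%:R / 2.

Let nodeS j : node j.+1 = node j + 1.
Proof. by rewrite /node -natr1; ring. Qed.

Let nodeN j : (j <= n.+1)%N -> node (n.+1 - j) = - node j.
Proof. by move=> hj; rewrite /node natrB//; field. Qed.

Let node_n mu : node n * mu = half mu.
Proof. by rewrite /node /half nSE nE; field. Qed.

Lemma wave_pair mu : wave (ccos mu) n (fun j => phi (node j * mu)).
Proof.
move=> j _; set a := node j.+1 * mu.
have -> : node j.+2 * mu = a + mu by rewrite nodeS mulrDl mul1r.
have -> : node j * mu = a - mu by rewrite /a nodeS; ring.
by rewrite !phiD ccosN csinN; ring.
Qed.

Lemma parity_pair mu : parity eps n (fun j => phi (node j * mu)).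
Proof. by move=> j hj; rewrite nodeN// mulNr phiN. Qed.

(** The derivative in mu of the wave phi (node j * mu), up to sign.  It is again a wave
because the derivative of 2 cos mu vanishes with sin mu. *)
Lemma wave_dpair mu : csin mu = 0 -> wave (ccos mu) n (fun j => node j * psi (node j * mu)).
Proof.
move=> s0 j _; set a := node j.+1 * mu.
have -> : node j.+2 * mu = a + mu by rewrite nodeS mulrDl mul1r.
have -> : node j * mu = a - mu by rewrite /a nodeS; ring.
by rewrite !psiD ccosN csinN s0 !nodeS; ring.
Qed.

Lemma parity_dpair mu : parity eps n (fun j => node j * psi (node j * mu)).
Proof. by move=> j hj; rewrite nodeN// (mulNr (node j) mu) psiN; ring. Qed.

Lemma ccos_sqr1 mu : csin mu = 0 -> ccos mu ^+ 2 = 1.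
Proof. by move=> s0; rewrite -(ccos2Dcsin2 mu) s0 expr0n addr0. Qed.

Lemma ccos_neq0 mu : csin mu = 0 -> ccos mu != 0.
Proof.
by move=> /ccos_sqr1 h; apply/eqP => c0; move/eqP: h; rewrite c0 expr0n eq_sym oner_eq0.
Qed.

Lemma csin_mul0 k mu : csin mu = 0 -> csin (k%:R * mu) = 0.
Proof. by rewrite csin_mulE => ->; rewrite mulr0. Qed.

Lemma csin_half0 mu : csin mu = 0 -> csin (half mu + half mu) = 0.
Proof.
move=> s0; have -> : half mu + half mu = n.-1%:R * mu by rewrite /half; field.
exact: csin_mul0.
Qed.

Lemma curve_lambda_sing mu : csin mu = 0 ->
  curve_lambda mu = n%:R * (phi (half mu) ^+ 2 - psi (half mu) ^+ 2).
Proof.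
move=> s0; rewrite /curve_lambda.
have sE k : (csin (k%:R * mu) = 0) by apply: csin_mul0.
rewrite (@lim_quot R _ _ n 1 (ccos (n%:R * mu)) (ccos mu) 1 mu) ?oner_eq0 ?ccos_neq0//.
- rewrite pair_cos2 (double mu) (ccosD (half mu + half mu) mu) s0 mulr0 subr0 mulr1.
  by field; exact: ccos_neq0.
- move=> w; have -> : n%:R * w = n%:R * mu + n%:R * (1 * (w - mu)) by ring.
  by rewrite csinD sE; ring.
- move=> w; have {1}-> : w = mu + 1 * (1 * (w - mu)) by ring.
  by rewrite csinD s0; ring.
Qed.

Lemma curve_lambda_reg mu : csin mu != 0 -> curve_lambda mu = eps * (csin (n%:R * mu) / csin mu).
Proof. by move=> s0; rewrite /curve_lambda /quot (negPf s0) andbF. Qed.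

(** Numerator and denominator both vanish here; the value is the quotient of their
derivatives. *)
Lemma curve_rho_sing mu : phi (half mu) = 0 -> csin mu = 0 ->
  curve_rho mu = n.+1%:R / n.-1%:R * ccos mu.
Proof.
move=> p0 s0.
have ps0 : psi (half mu) != 0.
  by apply/eqP => h; have /eqP := phi2Dpsi2 (half mu); rewrite p0 h expr0n addr0 eq_sym oner_eq0.
have e0 : eps != 0 by apply/eqP => h; move/eqP: eps2; rewrite h expr0n eq_sym oner_eq0.
rewrite /curve_rho (@lim_quot R _ _ n.+1 n.-1 (- eps * psi (half mu + mu)) (- eps * psi (half mu)) 2^-1 mu).
- rewrite psiD s0 mulr0 addr0; field.
  by rewrite ?n1_neq0 ?ps0 ?e0.
- by rewrite invr_eq0 pnatr_eq0.
- by rewrite mulf_neq0// oppr_eq0.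
- by case: n hn => [//|[]].
- move=> w; have -> : n.+1%:R * w / 2 = (half mu + mu) + n.+1%:R * (2^-1 * (w - mu)).
    by rewrite -halfD; field.
  by rewrite phiD (_ : phi (half mu + mu) = 0) ?phiD ?p0 ?s0; ring.
- move=> w; have -> : n.-1%:R * w / 2 = half mu + n.-1%:R * (2^-1 * (w - mu)).
    by rewrite /half; field.
  by rewrite phiD p0; ring.
Qed.

Lemma curve_rho_reg mu : phi (half mu) != 0 -> curve_rho mu = phi (half mu + mu) / phi (half mu).
Proof. by move=> p0; rewrite /curve_rho /quot (negPf p0) andbF halfD. Qed.

(** The wave attached to mu is phi (node j * mu), or its derivative in mu if this
vanishes at j = n.  The hypothesis excludes a pole of [curve_rho]. *)
Lemma curve_mode mu : (phi (half mu) = 0 -> csin mu = 0) ->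
  exists p, [/\ wave (ccos mu) n p, parity eps n p, p n.+1 = curve_rho mu * p n & p n != 0] /\
    curve_lambda mu * poisson_den (curve_rho mu) (ccos mu) = 1 - curve_rho mu ^+ 2 /\
    (poisson_den (curve_rho mu) (ccos mu) = 0 -> curve_lambda mu = n%:R).
Proof.
move=> reg; have [p0|p0] := eqVneq (phi (half mu)) 0.
  have s0 := reg p0; have c2 := ccos_sqr1 s0.
  have ps2 : psi (half mu) ^+ 2 = 1 by rewrite -(phi2Dpsi2 (half mu)) p0 expr0n add0r.
  have dE : poisson_den (curve_rho mu) (ccos mu) = 4 / n.-1%:R ^+ 2.
    rewrite /poisson_den curve_rho_sing//.
    transitivity (1 + (- 2 * (n.+1%:R / n.-1%:R) + (n.+1%:R / n.-1%:R) ^+ 2) * ccos mu ^+ 2); first by ring.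
    by rewrite c2 nSE; field.
  exists (fun j => node j * psi (node j * mu)); split; first split.
  - exact: wave_dpair.
  - exact: parity_dpair.
  - have e : (node n + 1) * mu = half mu + mu by rewrite mulrDl mul1r node_n.
    rewrite curve_rho_sing// nodeS e (node_n mu) psiD s0 mulr0 addr0.
    by rewrite /node nSE nE; field.
  - rewrite (node_n mu) mulf_neq0//.
      rewrite /node nSE nE (_ : _ - _ = n.-1%:R / 2); last by field.
      by rewrite mulf_neq0// invr_eq0 pnatr_eq0.
    by apply/eqP => h; move/eqP: ps2; rewrite h expr0n eq_sym oner_eq0.
  split.
    rewrite dE curve_lambda_sing// p0 ps2 curve_rho_sing// exprMn c2 nSE nE; field.
    by rewrite ?n1_neq0.
  rewrite dE => /eqP; rewrite mulf_eq0 invr_eq0 expf_eq0 /= (negPf n1_neq0) orbF.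
  by rewrite pnatr_eq0.
exists (fun j => phi (node j * mu)).
have dE : poisson_den (curve_rho mu) (ccos mu) * phi (half mu) ^+ 2 = csin mu ^+ 2.
  by rewrite -pair_poisson_den curve_rho_reg// /poisson_den; field.
have p2 : phi (half mu) ^+ 2 != 0 by rewrite expf_neq0.
split; first split.
- exact: wave_pair.
- exact: parity_pair.
- by rewrite curve_rho_reg// nodeS mulrDl mul1r node_n divfK.
- by rewrite node_n.
have [s0|s0] := eqVneq (csin mu) 0.
  have D0 : poisson_den (curve_rho mu) (ccos mu) = 0.
    by apply: (mulIf p2); rewrite dE s0 expr0n mul0r.
  have ps0 : psi (half mu) = 0.
    have /eqP := pair_sin2 (half mu); rewrite csin_half0// !mulf_eq0 (negPf p0) pnatr_eq0 /=.
    by move/eqP.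
  have ph2 : phi (half mu) ^+ 2 = 1 by rewrite -(phi2Dpsi2 (half mu)) ps0 expr0n addr0.
  rewrite D0 curve_lambda_sing// ps0 ph2 expr0n subr0 mulr1; split => //.
  have -> : curve_rho mu = ccos mu.
    by rewrite curve_rho_reg// phiD s0 mulr0 subr0 mulrAC divff// mul1r.
  by rewrite mulr0 ccos_sqr1// subrr.
split.
  apply: (mulIf p2); rewrite -mulrA dE curve_lambda_reg//.
  transitivity (eps * csin (n%:R * mu) * csin mu); first by field.
  by rewrite -pair_diff_sqr curve_rho_reg//; field.
move=> D0; move/eqP: dE; rewrite D0 mul0r eq_sym expf_eq0 /= => /eqP h.
by rewrite h eqxx in s0.
Qed.

Lemma eps_norm : `|eps| = 1.
Proof.
apply/eqP; rewrite -(eqrXn2 (isT : (0 < 2)%N)) ?normr_ge0// ?ler01//.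
by rewrite -normrX eps2 normr1 expr1n.
Qed.

Lemma curve_lambda_norm_reg mu : csin mu != 0 ->
  `|curve_lambda mu| * `|csin mu| = `|csin (n%:R * mu)|.
Proof.
move=> s0; rewrite curve_lambda_reg// normrM eps_norm mul1r normrM normfV divfK//.
by rewrite normr_eq0.
Qed.

Lemma curve_lambda_norm_sing mu : csin mu = 0 -> `|curve_lambda mu| = n%:R.
Proof.
move=> s0; rewrite curve_lambda_sing// pair_cos2 (normrM n%:R) (normrM eps) eps_norm mul1r normr_nat.
have c1 : `|ccos (half mu + half mu)| = 1.
  apply/eqP; rewrite -(eqrXn2 (isT : (0 < 2)%N)) ?normr_ge0// ?ler01//.
  by rewrite -normrX ccos_sqr1 ?csin_half0// normr1 expr1n.
by rewrite c1 mulr1.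
Qed.

Variable N : R.
Hypothesis hN : Nmin R n < N.

Let N_gt1 : 1 < N. Proof. exact: le_lt_trans (Nmin_ge1 _ hn) hN. Qed.

(** The singular points of the curve, where sin mu = 0, occur only for N = n. *)
Lemma vsol_facts u : urange n N u -> 0 <= vsol n N u /\ transc_eq n N u (vsol n N u) /\
  (sin u = 0 -> vsol n N u = 0 -> N = n%:R).
Proof.
move=> hu; have [nN|nN] := ltP n%:R N.
  have [h1 _ h2 _ _] := vsol_gt hn hN u nN.
  by split; [exact: ltW | split => // _ h; move: h1; rewrite h ltxx].
have [h1 h2 _] := vsol_le hn hN nN hu.
split => //; split => // su _; move: nN; rewrite le_eqVlt => /predU1P[//|nN].
exfalso; have [/andP[u1 _] _] := u0_spec hn hN nN.
move: hu; rewrite /urange /= ltNge (ltW nN) /= => hu.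
have upi : - pi <= u <= pi.
  by rewrite -ler_norml; move/andP: hu => [_ h]; lra.
case: ((sin_eq0_pi upi).1 su) => h; rewrite h ?normr0 in hu; lra.
Qed.

(** A pole of [curve_rho] on the curve would give lambda = -1, hence N = 1. *)
Lemma curve_eigenvalue u : urange n N u ->
  exists x : 'cV[R[i]]_n, [/\ x != 0, forall j, x (rev_ord j) 0 = eps * x j 0
    & KMS n (curve_rho (mu n N u)) *m x = curve_lambda (mu n N u) *: x] /\
  `|curve_lambda (mu n N u)| = N%:C.
Proof.
move=> hu; have [v0 [ev nv]] := vsol_facts hu.
have N1 := N_gt1; have N0 : 0 <= N by lra.
have ev' := (transc_norm n u (vsol n N u) N0).1 ev.
set m := mu n N u; rewrite -/(mu n N u) -/m in ev'.
have bN : `|curve_lambda m| = N%:C.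
  have [s0|s0] := eqVneq (csin m) 0.
    rewrite curve_lambda_norm_sing//; have [su vv] := (csin_eq0 _ _).1 s0.
    by rewrite (nv su vv) rmorph_nat.
  by apply: (mulIf (_ : `|csin m| != 0)); rewrite ?normr_eq0// curve_lambda_norm_reg.
have reg : phi (half m) = 0 -> csin m = 0.
  move=> p0; apply/eqP; apply: contraT => s0.
  have ps2 : psi (half m) ^+ 2 = 1 by rewrite -(phi2Dpsi2 (half m)) p0 expr0n add0r.
  have s2 : csin (half m + half m) = 0 by rewrite -pair_sin2 p0 mulr0 mul0r.
  have c2 := pair_cos2 (half m); rewrite p0 ps2 expr0n sub0r in c2.
  have : curve_lambda m = -1.
    rewrite curve_lambda_reg// double csinD s2 mul0r add0r mulfK// -c2 //.
  move=> h; move/eqP: bN; rewrite h normrN1 -[1]/(1%:C) eq_complex /= eqxx andbT => /eqP h1.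
  by move: N1; rewrite -h1 ltxx.
have [p [[hp sp pn pn0] [hb h0]]] := curve_mode reg.
have n0 : (0 < n)%N by apply: leq_trans hn.
have [x hx] := mode_eigenvector n0 eps2 hp sp pn pn0 hb h0.
by exists x.
Qed.

(** The eigenvector is a wave for some c = cos mu, and comparing it with the wave
attached to mu by [casoratian] gives rho; then lambda follows, and |lambda| = N puts mu
on the curve. *)
Lemma eigenvalue_on_curve rho lambda (x : 'cV[R[i]]_n) : x != 0 ->
    (forall j, x (rev_ord j) 0 = eps * x j 0) -> KMS n rho *m x = lambda *: x ->
    `|lambda| = N%:C ->
  exists u, [/\ urange n N u, rho = curve_rho (mu n N u) & lambda = curve_lambda (mu n N u)].
Proof.
move=> x0 xs xK lN; have N1 := N_gt1; have N0 : 0 <= N by lra.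
have n0 : (0 < n)%N by apply: leq_trans hn.
have l0 : lambda != 0.
  apply/eqP => l0; move/eqP: lN; rewrite l0 normr0 eq_complex /= eqxx andbT => /eqP h.
  by move: N1; rewrite -h; lra.
have r0 : rho != 0.
  apply/eqP => r0; have K1 : KMS n rho = 1%:M.
    apply/matrixP => i j; rewrite !mxE r0 expr0n; congr (_%:R); congr nat_of_bool.
    by rewrite distn_eq0.
  move: xK; rewrite K1 mul1mx => /esym/eqP; rewrite -subr_eq0 -{2}[x]scale1r -scalerBl.
  rewrite scaler_eq0 (negPf x0) orbF subr_eq0 => /eqP l1.
  move/eqP: lN; rewrite l1 normr1 -[1]/(1%:C) eq_complex /= eqxx andbT => /eqP h1.
  by move: N1; rewrite -h1 ltxx.
have [c [p [[hp sp pn pn0] [hl h0]]]] := eigenvector_mode n0 eps2 r0 l0 x0 xs xK.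
have [u [v [hu hv hc]]] := ccos_surj c.
set m := u +i* v in hc.
rewrite -hc in hp hl h0.
have reg : phi (half m) = 0 -> csin m = 0.
  move=> p0; have := casoratian eps2 hp (@wave_pair m) sp (@parity_pair m).
  have e : (node n + 1) * m = half m + m by rewrite mulrDl mul1r node_n.
  rewrite nodeS e (node_n m) p0 mulr0 => /esym/eqP.
  rewrite mulf_eq0 (negPf pn0) /= phiD p0 mul0r sub0r oppr_eq0 mulf_eq0.
  move=> /orP[|/eqP//]; rewrite mulf_eq0 => /orP[] /eqP h; exfalso.
    by move/eqP: eps2; rewrite h expr0n eq_sym oner_eq0.
  by have /eqP := phi2Dpsi2 (half m); rewrite p0 h expr0n addr0 eq_sym oner_eq0.
have [q [[hq sq qn qn0] [hb hb0]]] := curve_mode reg.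
have rE : rho = curve_rho m.
  have := casoratian eps2 hp hq sp sq; rewrite pn qn => h.
  apply: (mulIf (mulf_neq0 pn0 qn0)).
  by rewrite mulrA h; ring.
have lE : lambda = curve_lambda m.
  rewrite -rE in hb hb0; have [D0|D0] := eqVneq (poisson_den rho (ccos m)) 0.
    by rewrite h0// hb0.
  by apply: (mulIf D0); rewrite hl hb.
have et : transc_eq n N u v.
  apply/(transc_norm n u v N0); rewrite -/m -lN lE.
  have [s0|s0] := eqVneq (csin m) 0; last by rewrite curve_lambda_norm_reg.
  by rewrite s0 csin_mul0// normr0 mulr0.
have [|hr hv'] := vsol_complete hn hN hu hv et.
  move=> su vv; have s0 : csin m = 0 by apply/csin_eq0.
  have := curve_lambda_norm_sing s0; rewrite -lE lN -(rmorph_nat (real_complex R)) => /complexI //.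
by exists u; rewrite /mu -hv'.
Qed.

End Curves.

Theorem theorem4p1 (R : realType) (n : nat) (N : R)
  (hn : (3 <= n)%N) (hN : Nmin R n < N) :
  [/\ n%:R < N ->
      forall u : R, urange n N u ->
        [/\ exists! v : R, 0 < v /\ transc_eq n N u v,
            v0 n N <= vsol n N u
          & vsol n N u = v0 n N <-> u = 0 \/ `|u| = pi],
      N <= n%:R ->
      forall u : R, urange n N u ->
        exists! v : R, 0 <= v /\ transc_eq n N u v
    & forall rho lambda : R[i],
        (type1_eigenvalue (KMS n rho) lambda /\ `|lambda| = N%:C <->
         exists u : R, [/\ urange n N u, rho = f1 n N u & lambda = b1 n N u]) /\
        (type2_eigenvalue (KMS n rho) lambda /\ `|lambda| = N%:C <->
         exists u : R, [/\ urange n N u, rho = f2 n N u & lambda = b2 n N u])].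
Proof.
split.
- move=> nN u hu; have [h1 h2 h3 h4 h5] := vsol_gt hn hN u nN.
  split => //.
    by exists (vsol n N u); split => // v [v1 v2]; rewrite (h5 v).
  by rewrite h4; apply: sin_eq0_pi; apply: urange_pi hu.
- move=> nN u hu; have [h1 h2 h3] := vsol_le hn hN nN hu.
  by exists (vsol n N u); split => // v [v1 v2]; rewrite (h3 v).
move=> rho lambda; split.
- have e2 : (-1) ^+ 2 = 1 :> R[i] by rewrite sqrrN expr1n.
  have D1 (a b : R[i]) : csin (a + b) = csin a * ccos b - -1 * ccos a * csin b.
    by rewrite csinD; ring.
  have D2 (a b : R[i]) : ccos (a + b) = ccos a * ccos b + -1 * csin a * csin b.
    by rewrite ccosD; ring.
  have P1 (a : R[i]) : csin (- a) = -1 * csin a by rewrite csinN; ring.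
  have P2 (a : R[i]) : ccos (- a) = - -1 * ccos a by rewrite ccosN; ring.
  have Q (a : R[i]) : csin a ^+ 2 + ccos a ^+ 2 = 1 by rewrite addrC ccos2Dcsin2.
  have bE u : b1 n N u = curve_lambda (-1) n (mu n N u) by rewrite /curve_lambda mulN1r.
  split=> [[[x [x0 xs xK]] lN]|[u [hu -> ->]]].
    have xs' j : x (rev_ord j) 0 = -1 * x j 0 by rewrite xs mulN1r.
    have [u [h1 h2 h3]] := eigenvalue_on_curve e2 D1 D2 P1 P2 Q hn hN x0 xs' xK lN.
    by exists u; split => //; rewrite bE.
  have [x [[x0 xs xK] xN]] := curve_eigenvalue e2 D1 D2 P1 P2 Q hn hN hu.
  rewrite bE; split => //; exists x; split => // j.
  by rewrite xs mulN1r.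
- have e2 : 1 ^+ 2 = 1 :> R[i] by rewrite expr1n.
  have D1 (a b : R[i]) : ccos (a + b) = ccos a * ccos b - 1 * csin a * csin b.
    by rewrite ccosD; ring.
  have D2 (a b : R[i]) : csin (a + b) = csin a * ccos b + 1 * ccos a * csin b.
    by rewrite csinD; ring.
  have P1 (a : R[i]) : ccos (- a) = 1 * ccos a by rewrite ccosN; ring.
  have P2 (a : R[i]) : csin (- a) = - 1 * csin a by rewrite csinN; ring.
  have Q (a : R[i]) : ccos a ^+ 2 + csin a ^+ 2 = 1 := ccos2Dcsin2 a.
  have bE u : b2 n N u = curve_lambda 1 n (mu n N u) by rewrite /curve_lambda mul1r.
  split=> [[[x [x0 xs xK]] lN]|[u [hu -> ->]]].
    have xs' j : x (rev_ord j) 0 = 1 * x j 0 by rewrite xs mul1r.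
    have [u [h1 h2 h3]] := eigenvalue_on_curve e2 D1 D2 P1 P2 Q hn hN x0 xs' xK lN.
    by exists u; split => //; rewrite bE.
  have [x [[x0 xs xK] xN]] := curve_eigenvalue e2 D1 D2 P1 P2 Q hn hN hu.
  rewrite bE; split => //; exists x; split => // j.
  by rewrite xs mul1r.
Qed.
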